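(* Let $\alpha$ be a probability distribution on $[d]$ with $\alpha_1\ge\cdots\ge\alpha_d$, $n\ge1$, $k\in[d]$, and $\lambda\sim\mathrm{SW}^n(\alpha)$. Then \[ \mathbb E\Big[\sum_{i=1}^k\big(\lambda_i/n-\alpha_i\big)^2\Big]\le\frac{46k}{n}. \]
   Context: $\mathrm{SW}^n(\alpha)$ is the law of the RSK shape $\mathrm{shRSK}(\boldsymbol w)$ (Young diagram $\lambda_1\ge\cdots\ge\lambda_d\ge0$ whose first $k$ rows sum to the maximum total length of $k$ disjoint weakly increasing subsequences of $\boldsymbol w$), where $\boldsymbol w\in[d]^n$ has i.i.d. letters with law $\alpha$. *)

(* Defs.v *)
From HB Require Import structures.
From mathcomp Require Import all_boot all_order all_algebra.
Set Implicit Arguments. Unset Strict Implicit. Unset Printing Implicit Defensive.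
Import Order.TTheory GRing.Theory Num.Theory.

(* A word w in [d]^n is a finite function 'I_n -> 'I_d (letters 0..d-1
   stand for 1..d). *)

Definition incr_set (n d : nat) (w : {ffun 'I_n -> 'I_d}) (S : {set 'I_n}) : bool :=
  [forall i : 'I_n, forall j : 'I_n,
     [&& i \in S, j \in S & (i < j)%N] ==> (w i <= w j)%N].

Definition greene (n d : nat) (w : {ffun 'I_n -> 'I_d}) (k : nat) : nat :=
  \max_(F : {ffun 'I_k -> {set 'I_n}} |
          [forall j1 : 'I_k, forall j2 : 'I_k,
             (j1 != j2) ==> [disjoint F j1 & F j2]]
          && [forall j : 'I_k, incr_set w (F j)])
     \sum_(j < k) #|F j|.

(* Row i (0-indexed) of shRSK(w): lambda_{i+1} = greene (i+1) - greene i,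
   so that lambda_1 + ... + lambda_k = greene k. *)
Definition shRSK_row (n d : nat) (w : {ffun 'I_n -> 'I_d}) (i : nat) : nat :=
  greene w i.+1 - greene w i.

Definition word_prob (R : ringType) (n d : nat) (alpha : 'I_d -> R)
  (w : {ffun 'I_n -> 'I_d}) : R := (\prod_(t : 'I_n) alpha (w t))%R.

(* Main.v *)
Require Import Defs.
From HB Require Import structures.
From mathcomp Require Import all_boot all_order all_algebra.
From mathcomp Require Import zify ring lra.
Set Implicit Arguments. Unset Strict Implicit. Unset Printing Implicit Defensive.
Import Order.TTheory GRing.Theory Num.Theory.

(* Disjoint increasing subsequences are encoded by sets of levels moving up in time. Removing the
   highest level, or adding the lowest free one, shows that row [k] of the shape is at most the
   longest increasing subsequence of the letters [>= k], and at least the number of letters met by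
   some nonincreasing path of levels [<= k]. Each of these two bounds differs from the number of
   letters [k] by at most the total content of a system of queues driven by the word: the
   letters [> k] in the first row of the RSK tableau in the first case, queues in series in the
   second.

   After a random perturbation of the word, of probability of order [1 / sqrt n], the queues are
   subcritical and have an explicit invariant product of geometric laws. They are monotone in
   their initial state, so started empty they stay below equilibrium, where the second moment of
   the content is of order [n], uniformly in the alphabet. Since the number of letters [k] has
   variance at most [n], every row satisfies [E (lambda_k - alpha_k n)^2 <= 46 n].

   The field is arbitrary, possibly non-archimedean, so infinite sums are avoided: geometric laws
   are truncated to boxes, and invariance becomes an inequality from a box to a larger one. *)

(** * Greene invariants and moving sets of levels *)

Section Greene.
Variables n d : nat.
Implicit Types (w : {ffun 'I_n -> 'I_d}) (C : nat -> nat -> nat) (k : nat).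

(* [C t x] is the number of levels [< x] occupied at time [t], out of [k] distinct ones. *)
Definition profile k C :=
  [/\ forall t, C t 0 = 0,
      forall t x, C t x <= C t x.+1 <= (C t x).+1,
      forall t, C t d = k &
      forall t x, C t.+1 x <= C t x].

Definition covered w C : {set 'I_n} :=
  [set t : 'I_n | C t (w t) < C t (w t).+1].

Lemma profile_homo k C t x y : profile k C -> x <= y -> C t x <= C t y.
Proof.
case=> _ H _ _; move: x y; apply: (homo_leq (@leqnn) leq_trans) => // x.
by case/andP: (H t x).
Qed.

Lemma profile_anti k C x s t : profile k C -> s <= t -> C t x <= C s x.
Proof.
case=> _ _ _ H; move: s t; apply: (@homo_leq _ (C^~ x) (fun a b => b <= a)) => //.
by move=> a b c ab ca; apply: leq_trans ca ab.
Qed.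

Lemma profile_leq k C t x : profile k C -> C t x <= x.
Proof.
case=> H0 H1 _ _; elim: x => [|x IH]; first by rewrite H0.
by case/andP: (H1 t x) => _ /leq_trans; apply.
Qed.

(** The [j]-th subsequence consists of the letters met by the [j]-th lowest occupied level, which
    only moves up in time. *)
Lemma card_covered_greene w k C : profile k C -> #|covered w C| <= greene w k.
Proof.
move=> pC; have [H0 H1 Hd H2] := pC.
have Ck (t : 'I_n) : t \in covered w C -> C t (w t) < k.
  rewrite inE => /leq_trans; apply; rewrite -(Hd t).
  exact: profile_homo pC (ltn_ord _).
pose F := [ffun j : 'I_k => [set t in covered w C | C t (w t) == j]].
have -> : #|covered w C| = \sum_(j < k) #|F j|.
  rewrite -sum1_card (eq_bigr (fun t : 'I_n => \sum_(j < k) (C t (w t) == j))%N).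
    rewrite exchange_big /=; apply: eq_bigr => j _.
    by rewrite -sum1_card big_mkcond [RHS]big_mkcond /=;
       apply: eq_bigr => t _; rewrite /F ffunE !inE; case: (_ < _); case: eqP.
  move=> t /Ck lt; rewrite (bigD1 (Ordinal lt)) //= eqxx big1 ?addn0 // => j.
  by rewrite -val_eqE /= eq_sym => /negPf->.
apply: (@leq_bigmax_cond _ _ (fun F : {ffun 'I_k -> {set 'I_n}} => \sum_(j < k) #|F j|)).
apply/andP; split.
  apply/forallP => j1; apply/forallP => j2; apply/implyP => j12.
  rewrite -setI_eq0; apply/eqP/setP => t; rewrite !ffunE !inE.
  apply/negbTE; apply: contra j12 => /andP[/andP[_ /eqP e1] /andP[_ /eqP e2]].
  by apply/eqP/val_inj; rewrite /= -e1 -e2.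
apply/forallP => j; apply/forallP => s; apply/forallP => t.
apply/implyP; rewrite !ffunE !inE => /and3P[/andP[cs /eqP ejs] /andP[ct /eqP ejt] st].
(* If [w t < w s], then [j.+1 <= C t (w t).+1 <= C s (w t).+1 <= C s (w s) = j]. *)
rewrite leqNgt; apply/negP => lt.
have := profile_anti (w t).+1 pC (ltnW st).
have := profile_homo s pC lt; lia.
Qed.

(** The subsequence [F j] sits at the running maximum of its letters, and below all levels before
    its first letter; this counts the subsequences sitting below [x]. *)
Definition below w k (F : {ffun 'I_k -> {set 'I_n}}) t x :=
  #|[set j : 'I_k | [forall s, (s \in F j) && (s <= t) ==> (w s < x)]]|.

(* Paths sharing a level are pushed down to distinct free levels, as in parking functions. *)
Definition spread (k : nat) (B : nat -> nat -> nat) t x :=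
  minn x (\max_(z < k.+1) (B t (x + z) - z)).

Lemma spread_profile k B : k <= d ->
  (forall t x, B t x <= B t x.+1) -> (forall t x, B t x <= k) ->
  (forall t, B t d = k) -> (forall t x, B t.+1 x <= B t x) -> profile k (spread k B).
Proof.
move=> kd Bx Bk Bd Bt; split=> [t|t x|t|t x]; rewrite /spread.
- by rewrite min0n.
- set g := \max_(z < k.+1) _; set h := \max_(z < k.+1) _.
  have gh : g <= h.
    apply/bigmax_leqP => z _; apply: leq_trans (leq_bigmax z).
    by rewrite leq_sub2r // addSn.
  have hg : h <= g.+1.
    (* Term [z] of [h] exceeds term [z.+1] of [g] by at most one; the last term, at [z = k],
       vanishes since [B <= k]. *)
    apply/bigmax_leqP => z _; have [zk|zk] := ltnP z k.
      have lt : z.+1 < k.+1 by [].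
      have := @leq_bigmax _ (fun z : 'I_k.+1 => B t (x + z) - z) (Ordinal lt).
      by rewrite -/g /= addSnnS; lia.
    by have := Bk t (x.+1 + z); lia.
  by lia.
- have Bdz z : B t (d + z) = k.
    elim: z => [|z IH]; first by rewrite addn0.
    by apply/eqP; rewrite eqn_leq Bk -{1}IH addnS Bx.
  have -> : \max_(z < k.+1) (B t (d + z) - z) = k.
    apply/eqP; rewrite eqn_leq; apply/andP; split.
      by apply/bigmax_leqP => z _; rewrite Bdz leq_subr.
    by rewrite -{1}(subn0 k) -{1}(Bdz 0); apply: (leq_bigmax (ord0 : 'I_k.+1)).
  exact/minn_idPr.
- rewrite leq_min geq_minl /=; apply: leq_trans (geq_minr _ _) _.
  apply/bigmax_leqP => z _; apply: leq_trans (leq_bigmax z).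
  by rewrite leq_sub2r.
Qed.

(** Spreading loses no level in use: every term of [g] is below [h], the first one because of the
    jump, and term [z.+1] by comparison with term [z] of [h]. *)
Lemma spread_jump k B t x :
  (forall x, B t x <= k) ->
  B t x < B t x.+1 -> spread k B t x < spread k B t x.+1.
Proof.
move=> Bk lt; rewrite /spread.
set g := \max_(z < k.+1) _; set h := \max_(z < k.+1) _.
suff gh : g < h by rewrite ltn_min !gtn_min ltnSn gh orbT !orTb.
have h0 : B t x.+1 <= h.
  by rewrite -(subn0 (B t _)) -(addn0 x.+1); apply: (leq_bigmax (ord0 : 'I_k.+1)).
have hpos : 0 < h by apply: leq_trans h0; apply: leq_ltn_trans lt.
rewrite -(prednK hpos) ltnS; apply/bigmax_leqP => -[[|z] zk] _ /=.
  by rewrite addn0 subn0; lia.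
have lt' : z < k.+1 by exact: ltnW.
have := @leq_bigmax _ (fun z : 'I_k.+1 => B t (x.+1 + z) - z) (Ordinal lt').
by rewrite -/h /= addSnnS; lia.
Qed.

(** Converse of [card_covered_greene]: the running maxima of an optimal family, spread to distinct
    levels, still cover all its letters. *)
Lemma greene_covered w k : k <= d ->
  exists2 C, profile k C & greene w k <= #|covered w C|.
Proof.
move=> kd.
pose P (F : {ffun 'I_k -> {set 'I_n}}) := [forall j1 : 'I_k, forall j2 : 'I_k,
             (j1 != j2) ==> [disjoint F j1 & F j2]]
          && [forall j : 'I_k, incr_set w (F j)].
have P0 : 0 < #|P|.
  apply/card_gt0P; exists [ffun => set0]; rewrite unfold_in; apply/andP; split.
    apply/forallP => j1; apply/forallP => j2; apply/implyP => _.
    by rewrite -setI_eq0 !ffunE set0I.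
  apply/forallP => j; apply/forallP => s; apply/forallP => t.
  by rewrite ffunE inE.
have [F /andP[disF incF] maxF] := eq_bigmax_cond
  (fun F : {ffun 'I_k -> {set 'I_n}} => \sum_(j < k) #|F j|) P0.
have -> : greene w k = \sum_(j < k) #|F j| by rewrite -maxF /greene; apply: eq_bigl.
pose B := below w F.
have Bk t x : B t x <= k by rewrite -[X in _ <= X]card_ord; apply: max_card.
exists (spread k B).
  apply: spread_profile => // [t x|t|t x].
  - apply/subset_leq_card/subsetP => j; rewrite !inE => /forallP H.
    apply/forallP => s; apply/implyP => /(implyP (H s)) /ltnW.
    by rewrite -ltnS.
  - rewrite /B /below (_ : [set _ | _] = setT) ?cardsT ?card_ord //.
    by apply/setP => j; rewrite !inE; apply/forallP => s; rewrite ltn_ord implybT.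
  - apply/subset_leq_card/subsetP => j; rewrite !inE => /forallP H.
    apply/forallP => s; apply/implyP => /andP[sF st].
    by apply: (implyP (H s)); rewrite sF ltnW.
have -> : \sum_(j < k) #|F j| = #|\bigcup_j F j|.
  rewrite -sum1_card partition_disjoint_bigcup => [|i j ij].
    by apply: eq_bigr => j _; rewrite sum1_card.
  exact: implyP (forallP (forallP disF i) j) ij.
apply/subset_leq_card/bigcupsP => j _; apply/subsetP => t tF.
rewrite inE; apply: spread_jump => //.
(* When [F j] takes the letter at time [t], its running maximum is exactly [w t], so [B t] jumps
   there. *)
apply/proper_card/properP; split.
  apply/subsetP => j'; rewrite !inE => /forallP H.
  apply/forallP => s; apply/implyP => /(implyP (H s)) /ltnW.
  by rewrite -ltnS.
have /forallP/(_ j)/forallP incj := incF.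
exists j; rewrite !inE.
  apply/forallP => s; apply/implyP => /andP[sF]; rewrite leq_eqVlt => /orP[/eqP/val_inj->//|st].
  by rewrite ltnS; apply: (implyP (forallP (incj s) t)); rewrite sF tF st.
by rewrite negb_forall; apply/existsP; exists t; rewrite tF leqnn ltnn.
Qed.

(** Deleting the highest of [k.+1] levels leaves a profile of [k] levels. [D] collects the letters
    on the deleted level, which is at least [k] because [k] distinct levels lie under it. *)
Lemma greene_succ_le w k : k < d ->
  exists2 D : {set 'I_n}, incr_set w D /\ (forall t, t \in D -> k <= w t) &
    greene w k.+1 <= greene w k + #|D|.
Proof.
move=> kd; have [C pC leC] := greene_covered w kd.
have [H0 H1 Hd H2] := pC.
exists [set t : 'I_n | (C t (w t) == k) && (C t (w t).+1 == k.+1)].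
  split=> [|t]; last by rewrite inE => /andP[/eqP<- _]; apply: (profile_leq _ _ pC).
  apply/forallP => s; apply/forallP => t; apply/implyP; rewrite !inE.
  move=> /and3P[/andP[/eqP a /eqP b] /andP[/eqP c /eqP e] st].
  rewrite leqNgt; apply/negP => lt.
  have := profile_anti (w t).+1 pC (ltnW st).
  have := profile_homo s pC lt; lia.
apply: leq_trans leC _.
have pC' : profile k (fun t x => minn (C t x) k).
  split=> [t|t x|t|t x]; rewrite ?H0 ?min0n //.
  - by have := H1 t x; lia.
  - by rewrite Hd; lia.
  - by have := H2 t x; lia.
apply: leq_trans (leq_add (card_covered_greene w pC') (leqnn _)).
rewrite (leq_trans _ (leq_card_setU _ _).1) //.
apply/subset_leq_card/subsetP => t; rewrite !inE => lt.
have := H1 t (w t); have := profile_homo t pC (ltn_ord (w t)); rewrite Hd.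
by lia.
Qed.

(** The path [u] is the lowest free level, and occupying it gives a profile of [k.+1] levels. It
    never rises because occupied levels only move up. *)
Lemma greene_succ_ge w k : k < d ->
  exists2 u : nat -> nat, (forall t, u t.+1 <= u t <= k) &
    greene w k + #|[set t : 'I_n | w t == u t :> nat]| <= greene w k.+1.
Proof.
move=> kd; have [C pC leC] := greene_covered w (ltnW kd).
have [H0 H1 Hd H2] := pC.
have exu t : exists x, C t x.+1 != x.+1.
  exists d; apply/eqP => e; have := H1 t d; rewrite Hd; lia.
pose u t := ex_minn (exu t).
have uP t : C t (u t) = u t /\ C t (u t).+1 = u t.
  rewrite /u; case: ex_minnP => x hx hmin.
  have e : C t x = x.
    case: x {hx} hmin => [//|x] hmin; apply/eqP; apply: contraT => /hmin; lia.
  by split=> //; have := H1 t x; have := profile_leq t x.+1 pC; move/eqP: hx; lia.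
have u_fill t x : x <= u t -> C t x = x.
  case: x => [//|x]; rewrite /u; case: ex_minnP => y hy hmin xy.
  by apply/eqP; apply: contraT => /hmin; lia.
exists u.
  move=> t; apply/andP; split; last first.
    have [<- _] := uP t; rewrite -[X in _ <= X](Hd t) leqNgt; apply/negP => lt.
    have ud : u t <= d.
      rewrite leqNgt; apply/negP => /ltnW du; have := u_fill t _ du; rewrite Hd; lia.
    by have := profile_homo t pC ud; lia.
  rewrite leqNgt; apply/negP => lt.
  have [_ e] := uP t; have := u_fill _ _ lt; have := H2 t (u t).+1; lia.
(* Up to [u t] all levels are occupied and the minimum is [x]; beyond it, one more level is
   counted. *)
pose C' t x := minn x (C t x).+1.
have pC' : profile k.+1 C'.
  split=> [t|t x|t|t x]; rewrite /C' ?min0n //.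
  - by have := H1 t x; lia.
  - by rewrite Hd; lia.
  - by have := H2 t x; lia.
apply: leq_trans (card_covered_greene w pC').
apply: leq_trans (leq_add leC (leqnn _)) _.
set A := [set t : 'I_n | _].
have dis : [disjoint covered w C & A].
  rewrite -setI_eq0; apply/eqP/setP => t; rewrite !inE.
  by apply/negbTE/negP => /andP[lt /eqP e]; have := uP t; rewrite -e; lia.
move: (leq_card_setU (covered w C) A) => [_]; rewrite dis => /eqP <-.
apply/subset_leq_card/subsetP => t; rewrite !inE /C' => /orP[lt|/eqP e].
  by have := profile_leq t (w t) pC; have := profile_leq t (w t).+1 pC; lia.
by have := uP t; rewrite -e; lia.
Qed.

(** An empty subsequence can be appended. Hence the truncated subtraction in [shRSK_row] is
    exact. *)
Lemma greene_mono w k : greene w k <= greene w k.+1.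
Proof.
apply/bigmax_leqP => F /andP[/forallP dF /forallP iF].
pose F' : {ffun 'I_k.+1 -> {set 'I_n}} :=
  [ffun j : 'I_k.+1 => if unlift ord_max j is Some i then F i else set0].
have -> : \sum_(j < k) #|F j| = \sum_(j < k.+1) #|F' j|.
  rewrite big_ord_recr /= {2}/F' ffunE unlift_none cards0 addn0.
  apply: eq_bigr => j _; rewrite /F' ffunE.
  have -> : widen_ord (leqnSn k) j = lift ord_max j.
    by apply: val_inj; rewrite /= /bump leqNgt ltn_ord.
  by rewrite liftK.
apply: (@leq_bigmax_cond _ _ (fun F : {ffun 'I_k.+1 -> {set 'I_n}} => \sum_(j < k.+1) #|F j|)).
apply/andP; split; apply/forallP => j.
  apply/forallP => j2; apply/implyP; rewrite !ffunE.
  case: unliftP => [i ->|->]; case: unliftP => [i2 ->|->] // ne.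
  - by apply: (implyP (forallP (dF i) i2)); apply: contraNneq ne => ->.
  - by rewrite disjoint_sym -setI_eq0 set0I.
  - by rewrite -setI_eq0 set0I.
  - by rewrite eqxx in ne.
rewrite ffunE; case: unliftP => [i _|_] //.
by apply/forallP => s; apply/forallP => t; rewrite inE.
Qed.
End Greene.

Local Open Scope ring_scope.

(** * Expectation over words with independent letters *)

Section Expectation.
Variable R : realFieldType.
Implicit Types J : finType.

(** Recursion on the first letter lets a run be unfolded one step at a time; [Exp_ffun] identifies
    the result with a sum over words. *)
Fixpoint Exp J (p : J -> R) n (F : seq J -> R) : R :=
  if n is m.+1 then \sum_j p j * Exp p m (fun s => F (j :: s)) else F [::].

Lemma eq_Exp J (p : J -> R) n F G : F =1 G -> Exp p n F = Exp p n G.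
Proof.
elim: n F G => [|n IH] F G FG //=.
by apply: eq_bigr => j _; congr (_ * _); apply: IH => s.
Qed.

Lemma le_Exp J (p : J -> R) n F G : (forall j, 0 <= p j) ->
  (forall s, size s = n -> F s <= G s) -> Exp p n F <= Exp p n G.
Proof.
move=> p0; elim: n F G => [|n IH] F G FG /=; first exact: FG.
by apply: ler_sum => j _; apply: ler_wpM2l => //; apply: IH => s sz; apply: FG; rewrite /= sz.
Qed.

Lemma ExpD J (p : J -> R) n F G : Exp p n (fun s => F s + G s) = Exp p n F + Exp p n G.
Proof.
elim: n F G => [|n IH] F G //=.
by rewrite -big_split; apply: eq_bigr => j _; rewrite IH mulrDr.
Qed.

Lemma ExpZ J (p : J -> R) n a F : Exp p n (fun s => a * F s) = a * Exp p n F.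
Proof.
elim: n F => [|n IH] F //=.
by rewrite mulr_sumr; apply: eq_bigr => j _; rewrite IH mulrCA.
Qed.

Lemma Exp_const J (p : J -> R) n a : \sum_j p j = 1 -> Exp p n (fun=> a) = a.
Proof. by move=> p1; elim: n => [|n IH] //=; rewrite IH -mulr_suml p1 mul1r. Qed.

Lemma Exp_ge0 J (p : J -> R) n F : (forall j, 0 <= p j) -> (forall s, 0 <= F s) ->
  0 <= Exp p n F.
Proof.
move=> p0; elim: n F => [|n IH] F F0 //=.
by apply: sumr_ge0 => j _; rewrite mulr_ge0 // IH.
Qed.

(** Image laws: used to attach coins to the letters, and to replace the perturbation of a letter by
    the law of the perturbed letter. *)
Lemma Exp_map J J' (f : J' -> J) (q : J' -> R) (p : J -> R) n F :
  (forall y, \sum_(x | f x == y) q x = p y) ->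
  Exp q n (fun s => F (map f s)) = Exp p n F.
Proof.
move=> qp; elim: n F => [|n IH] F //=.
rewrite (partition_big f xpredT) //=; apply: eq_bigr => y _.
by rewrite -qp mulr_suml; apply: eq_bigr => x /eqP <-; rewrite -IH.
Qed.

Lemma Exp_ffun J (p : J -> R) n F :
  \sum_(w : {ffun 'I_n -> J}) (\prod_t p (w t)) * F (codom w) = Exp p n F.
Proof.
elim: n F => [|n IH] F /=.
  have E (w : {ffun 'I_0 -> J}) : codom w = [::].
    by rewrite codomE; case: (enum 'I_0) (size_enum_ord 0) => // /=.
  rewrite (eq_bigr (fun=> F [::])) => [|w _]; last by rewrite big_ord0 mul1r E.
  by rewrite sumr_const card_ffun card_ord expn0 mulr1n.
pose h (x : J * {ffun 'I_n -> J}) : {ffun 'I_n.+1 -> J} :=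
  [ffun t => if unlift ord0 t is Some t' then x.2 t' else x.1].
pose g (w : {ffun 'I_n.+1 -> J}) := (w ord0, [ffun t => w (lift ord0 t)]).
have hg : cancel h g.
  move=> [j w]; rewrite /g /h ffunE unlift_none /=; congr (_, _).
  by apply/ffunP => t; rewrite !ffunE liftK.
have gh : cancel g h.
  move=> w; apply/ffunP => t; rewrite ffunE /=.
  by case: unliftP => [t' ->|->]; rewrite ?ffunE.
rewrite (reindex h) /=; last by exists g => x _; [exact: hg | exact: gh].
rewrite (eq_bigr (fun j => \sum_(w : {ffun 'I_n -> J})
    p j * (\prod_t p (w t)) * F (j :: codom w))); last first.
  move=> j _; rewrite -IH mulr_sumr; apply: eq_bigr => w _.
  by rewrite mulrA.
rewrite pair_bigA /=; apply: eq_bigr => -[j w] _ /=.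
have h0 : h (j, w) ord0 = j by rewrite ffunE unlift_none.
have hS t : h (j, w) (lift ord0 t) = w t by rewrite ffunE liftK.
rewrite big_ord_recl h0 (eq_bigr (fun t => p (w t))) => [|t _]; last by rewrite hS.
congr (_ * F _); rewrite !codomE enum_ordSl /= h0 -map_comp; congr (_ :: _).
by apply: eq_map => t; rewrite /= hS.
Qed.

Lemma Exp_sum J (p f : J -> R) n : \sum_j p j = 1 ->
  Exp p n (fun s => \sum_(x <- s) f x) = n%:R * \sum_j p j * f j.
Proof.
move=> p1; elim: n => [|n IH] /=; first by rewrite big_nil mul0r.
rewrite (eq_bigr (fun j => p j * f j + p j * Exp p n (fun s => \sum_(x <- s) f x))).
  by rewrite big_split /= -mulr_suml p1 mul1r IH; ring.
move=> j _; rewrite -mulrDr; congr (_ * _).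
rewrite -[X in X + _](Exp_const n (f j) p1) -ExpD; apply: eq_Exp => s.
by rewrite big_cons.
Qed.

Lemma Exp_sum_sqr J (p f : J -> R) n : \sum_j p j = 1 ->
  Exp p n (fun s => (\sum_(x <- s) f x) ^+ 2) =
  n%:R * (\sum_j p j * f j ^+ 2) + (n * n.-1)%:R * (\sum_j p j * f j) ^+ 2.
Proof.
move=> p1; set m := \sum_j p j * f j; set v := \sum_j _.
elim: n => [|n IH] /=; first by rewrite big_nil; ring.
rewrite (eq_bigr (fun j => p j * f j ^+ 2 + p j * f j * (2 * (n%:R * m)) +
   p j * Exp p n (fun s => (\sum_(x <- s) f x) ^+ 2))).
  rewrite !big_split /= -!mulr_suml p1 IH -/m -/v.
  by case: n {IH} => [|n] /=; rewrite ?natrM -?natr1; ring.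
move=> j _; transitivity (p j * (f j ^+ 2 + f j * 2 * Exp p n (fun s => \sum_(x <- s) f x) +
    Exp p n (fun s => (\sum_(x <- s) f x) ^+ 2))); last by rewrite Exp_sum // -/m; ring.
congr (_ * _); rewrite -ExpZ -[X in X + _ + _](Exp_const n (f j ^+ 2) p1) -!ExpD.
by apply: eq_Exp => s; rewrite big_cons; ring.
Qed.

End Expectation.

(** * Products of truncated geometric laws *)

Section GeometricProduct.
Variables (R : realFieldType) (I : finType) (rho m : I -> R).
Hypothesis m_ge0 : forall i, 0 <= m i.
(* [m i] is the mean of the geometric law of ratio [rho i]. *)
Hypothesis rho_m : forall i, rho i * (1 + m i) = m i.

Notation state := {ffun I -> nat}.
Definition load (Q : state) : nat := (\sum_i Q i)%N.
Definition weight (Q : state) : R := \prod_i rho i ^+ Q i.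
Definition box K : seq state := [seq [ffun i => nat_of_ord (f i)] | f : {ffun I -> 'I_K}].
Definition mass K : R := \sum_(Q <- box K) weight Q.

Lemma rho_mE i : rho i * m i = m i - rho i.
Proof. by rewrite -{2}(rho_m i); ring. Qed.

Lemma rho_ge0 i : 0 <= rho i.
Proof.
have m1 : 0 < 1 + m i by have := m_ge0 i; lra.
by rewrite -(pmulr_lge0 _ m1) rho_m.
Qed.

Lemma weight_ge0 Q : 0 <= weight Q.
Proof. by apply: prodr_ge0 => i _; rewrite exprn_ge0 ?rho_ge0. Qed.

Lemma mem_box K Q : (Q \in box K) = [forall i, (Q i < K)%N].
Proof.
apply/imageP/forallP => [[f _ ->] i|lt]; first by rewrite ffunE.
by exists [ffun i => Ordinal (lt i)] => //; apply/ffunP => i; rewrite !ffunE.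
Qed.

Lemma box_uniq K : uniq (box K).
Proof.
rewrite map_inj_uniq ?enum_uniq // => f g /ffunP fg.
by apply/ffunP => i; apply: val_inj; have := fg i; rewrite !ffunE.
Qed.

Lemma sum_box_prod K (h : I -> nat -> R) :
  \sum_(Q <- box K) \prod_i h i (Q i) = \prod_i \sum_(x < K) h i x.
Proof.
rewrite big_image /= bigA_distr_bigA; apply: eq_bigr => f _.
by apply: eq_bigr => i _; rewrite ffunE.
Qed.

Lemma geom_sum0 i K : \sum_(x < K) rho i ^+ x = (1 + m i) * (1 - rho i ^+ K).
Proof.
elim: K => [|K IH]; first by rewrite big_ord0 expr0; ring.
by rewrite big_ord_recr /= IH exprS; ring: (rho_mE i).
Qed.

(** Induction gives the exact difference, a nonnegative boundary term at [K]: truncation only lowers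
    the mean. The second moment below is treated alike. *)
Lemma geom_sum1 i K :
  \sum_(x < K) rho i ^+ x * x%:R <= m i * \sum_(x < K) rho i ^+ x.
Proof.
suff -> : m i * \sum_(x < K) rho i ^+ x =
    \sum_(x < K) rho i ^+ x * x%:R + rho i ^+ K * (1 + m i) * K%:R.
  have m0 := m_ge0 i; have r0 : 0 <= rho i ^+ K by rewrite exprn_ge0 ?rho_ge0.
  by rewrite lerDl !mulr_ge0 ?ler0n //; lra.
elim: K => [|K IH]; first by rewrite !big_ord0; ring.
rewrite !big_ord_recr /= mulrDr IH (exprS (rho i) K) -natr1.
have -> : rho i * rho i ^+ K * (1 + m i) = rho i ^+ K * m i by rewrite mulrAC rho_m mulrC.
ring.
Qed.

Lemma geom_sum2 i K :
  \sum_(x < K) rho i ^+ x * x%:R ^+ 2 <= (m i + 2 * m i ^+ 2) * \sum_(x < K) rho i ^+ x.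
Proof.
have m0 := m_ge0 i.
suff -> : (m i + 2 * m i ^+ 2) * \sum_(x < K) rho i ^+ x =
    \sum_(x < K) rho i ^+ x * x%:R ^+ 2 +
    rho i ^+ K * (1 + m i) * (K%:R ^+ 2 + 2 * m i * K%:R).
  have r0 : 0 <= rho i ^+ K by rewrite exprn_ge0 ?rho_ge0.
  have K0 : 0 <= K%:R :> R by rewrite ler0n.
  rewrite lerDl !mulr_ge0 //; first by lra.
  by rewrite addr_ge0 ?exprn_ge0 ?mulr_ge0.
elim: K => [|K IH]; first by rewrite !big_ord0; ring.
rewrite !big_ord_recr /= mulrDr IH (exprS (rho i) K) -natr1.
have -> : rho i * rho i ^+ K * (1 + m i) = rho i ^+ K * m i by rewrite mulrAC rho_m mulrC.
ring.
Qed.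

Lemma massE K : mass K = \prod_i \sum_(x < K) rho i ^+ x.
Proof. exact: (sum_box_prod K (fun i x => rho i ^+ x)). Qed.

(** By independence the sum factors over coordinates, and each factor is bounded by a truncated
    moment. For [a = b], the second moment [m a + 2 * m a ^+ 2] is [m a * m a] plus the variance. *)
Lemma pair_moment K a b :
  \sum_(Q <- box K) weight Q * ((Q a)%:R * (Q b)%:R) <=
  (m a * m b + (a == b)%:R * (m a + m a ^+ 2)) * mass K.
Proof.
pose h i x : R := rho i ^+ x * (if i == a then x%:R else 1) * (if i == b then x%:R else 1).
have if1 c (F : I -> R) : \prod_i (if i == c then F i else 1) = F c.
  by rewrite -big_mkcond /= big_pred1_eq.
have E Q : weight Q * ((Q a)%:R * (Q b)%:R) = \prod_i h i (Q i).
  by rewrite /h !big_split /= (if1 a (fun i => (Q i)%:R)) (if1 b (fun i => (Q i)%:R)) mulrA.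
rewrite (eq_bigr _ (fun Q _ => E Q)) sum_box_prod massE.
pose c i := if a == b then (if i == a then m i + 2 * m i ^+ 2 else 1)
  else (if i == a then m i else 1) * (if i == b then m i else 1).
have -> : m a * m b + (a == b)%:R * (m a + m a ^+ 2) = \prod_i c i.
  rewrite /c; case: eqP => [<-|_]; last by rewrite big_split /= !if1 mul0r addr0.
  by rewrite (if1 a (fun i => m i + 2 * m i ^+ 2)) mul1r; ring.
rewrite -big_split /=; apply: ler_prod => i _; apply/andP; split.
  apply: sumr_ge0 => x _; rewrite /h !mulr_ge0 ?exprn_ge0 ?rho_ge0 //; by case: ifP.
rewrite /c /h; have [<-|ab] := eqVneq a b.
  case: ifP => _; last by rewrite mul1r; apply: ler_sum => x _; rewrite !mulr1.
  by apply: le_trans (geom_sum2 i K); apply: ler_sum => x _; rewrite -mulrA -expr2.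
have [->|_] := eqVneq i a.
  rewrite (negbTE ab) mulr1; under eq_bigr do rewrite mulr1.
  exact: geom_sum1.
case: ifP => _; last by rewrite !mul1r; under eq_bigr do rewrite !mulr1.
by rewrite mul1r; under eq_bigr do rewrite mulr1; exact: geom_sum1.
Qed.

(** The second moment of the load under the untruncated product law: the squared mean plus the
    variances [m i + m i ^+ 2]. *)
Definition variance_bound : R :=
  (\sum_i m i) ^+ 2 + \sum_i m i ^+ 2 + \sum_i m i.

Lemma load_moment K :
  \sum_(Q <- box K) weight Q * (load Q)%:R ^+ 2 <= variance_bound * mass K.
Proof.
have E Q : weight Q * (load Q)%:R ^+ 2 =
    \sum_a \sum_b weight Q * ((Q a)%:R * (Q b)%:R).
  rewrite /load natr_sum expr2 big_distrlr /= mulr_sumr.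
  by apply: eq_bigr => a _; rewrite mulr_sumr.
rewrite (eq_bigr _ (fun Q _ => E Q)) exchange_big /=.
have -> : variance_bound * mass K =
    \sum_a \sum_b (m a * m b + (a == b)%:R * (m a + m a ^+ 2)) * mass K.
  under eq_bigr do rewrite -mulr_suml big_split /= -mulr_sumr.
  rewrite -mulr_suml big_split /= -mulr_suml /variance_bound expr2 -addrA; congr ((_ + _) * _).
  rewrite addrC -big_split /=; apply: eq_bigr => a _.
  by rewrite (bigD1 a) //= eqxx mul1r big1 ?addr0 // => b; rewrite eq_sym => /negPf ->; rewrite mul0r.
apply: ler_sum => a _; rewrite exchange_big /=; apply: ler_sum => b _.
exact: pair_moment.
Qed.

(** An explicit decay rate, which stands in for a limit. *)
Lemma rho_pow i K : rho i ^+ K * (m i + K%:R) <= m i.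
Proof.
have m0 := m_ge0 i; elim: K => [|K IH]; first by rewrite expr0 mul1r addr0.
apply: le_trans IH; rewrite exprSr -mulrA ler_wpM2l ?exprn_ge0 ?rho_ge0 //.
have -> : rho i * (m i + K.+1%:R) = m i + rho i * K%:R.
  by rewrite -natr1; ring: (rho_mE i).
rewrite lerD2l ler_piMl //; have r0 := rho_ge0 i; have := rho_m i; nra.
Qed.

Lemma rho_le1 i : rho i <= 1.
Proof. have r0 := rho_ge0 i; have m0 := m_ge0 i; have := rho_m i; nra. Qed.

Lemma mass_gt0 K : (0 < K)%N -> 0 < mass K.
Proof.
case: K => // K _; rewrite massE; apply: prodr_gt0 => i _.
rewrite big_ord_recl expr0 ltr_wpDr // sumr_ge0 // => x _.
by rewrite exprn_ge0 ?rho_ge0.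
Qed.

(** Every box has mass at most [\prod_i (1 + m i)], and a large enough one carries half of that. *)
Lemma mass_growth M n : (forall i, m i <= M%:R) ->
  exists2 K, (0 < K)%N & mass (K + n) <= 2 * mass K.
Proof.
(* By [rho_pow] this size makes each [rho i ^+ K] at most [1 / (2 * #|I|)]; the successor keeps it
   positive. *)
move=> mM; pose K := (2 * #|I| * M).+1; exists K => //.
pose x i := rho i ^+ K.
have x01 i : 0 <= x i <= 1 by rewrite exprn_ge0 ?exprn_ile1 ?rho_ge0 ?rho_le1.
have massP L : mass L = (\prod_i (1 + m i)) * \prod_i (1 - rho i ^+ L).
  by rewrite massE -big_split; apply: eq_bigr => i _; rewrite geom_sum0.
set P := \prod_i (1 + m i) in massP.
have P0 : 0 <= P by apply: prodr_ge0 => i _; rewrite addr_ge0.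
have le1 : \prod_i (1 - rho i ^+ (K + n)) <= 1.
  apply: prodr_ile1 => i _; rewrite subr_ge0 exprn_ile1 ?rho_ge0 ?rho_le1 //=.
  by rewrite gerBl exprn_ge0 ?rho_ge0.
have sx : \sum_i x i <= 2^-1.
  have xi i : x i * (2 * #|I|)%:R <= 1.
    have [M0|M0] := posnP M.
      have mi0 : m i = 0 by apply: le_anti; rewrite m_ge0 (le_trans (mM i)) // M0.
      have := rho_m i; rewrite mi0 addr0 mulr1 => r0.
      by rewrite /x /K r0 expr0n mul0r ler01.
    have := rho_pow i K; rewrite -/(x i) => le.
    have /andP[x0 _] := x01 i; have mi := m_ge0 i; have miM := mM i.
    have : x i * ((2 * #|I|)%:R * M%:R) <= M%:R.
      apply: le_trans miM; apply: le_trans le; rewrite ler_wpM2l // -natrM.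
      by rewrite (le_trans (y := K%:R)) ?lerDr // ler_nat /K leqnSn.
    by rewrite mulrA ger_pMl ?ltr0n.
  have [I0|I0] := posnP #|I|.
    rewrite big1 ?invr_ge0 ?ler0n // => i _.
    by have := fintype0 i I0.
  rewrite -(ler_pM2r (x := (2 * #|I|)%:R)) ?ltr0n ?muln_gt0 // mulr_suml.
  apply: le_trans (ler_sum _ (fun i _ => xi i)) _.
  by rewrite sumr_const natrM mulKf ?pnatr_eq0.
(* Weierstrass product inequality, proved together with the upper bound [1] that its induction
   needs. *)
have ge : 1 - \sum_i x i <= \prod_i (1 - x i).
  suff /andP[] : (1 - \sum_i x i <= \prod_i (1 - x i)) && (\prod_i (1 - x i) <= 1) by [].
  elim: (index_enum I) => [|i s IH]; first by rewrite !big_nil subr0 lexx.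
  rewrite !big_cons; have /andP[x0 x1] := x01 i.
  have := IH; set a := \sum_(j <- s) _; set b := \prod_(j <- s) _ => /andP[h1 h2].
  by apply/andP; split; nra.
rewrite !massP mulrCA ler_wpM2l //.
rewrite -/(x _) in ge *; apply: le_trans le1 _; rewrite /x in ge sx *; lra.
Qed.

End GeometricProduct.

(** * Monotone reversible dynamics *)

Lemma ler_sum_inj (R : numDomainType) (S T : eqType) (s : seq S) (t : seq T)
    (h : S -> T) (G : T -> R) :
  (forall y, 0 <= G y) -> uniq s -> {in s &, injective h} ->
  (forall x, x \in s -> h x \in t) ->
  \sum_(x <- s) G (h x) <= \sum_(y <- t) G y.
Proof.
move=> G0; elim: s t => [|x s IH] t; first by rewrite big_nil sumr_ge0.
move=> /= /andP[xs us] inj st; rewrite big_cons (big_rem (h x)) /=; last first.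
  by rewrite st ?mem_head.
rewrite lerD2l; apply: IH => // [y z ys zs|y ys].
  by apply: inj; rewrite inE ?ys ?zs orbT.
rewrite (rem_mem _ (st y _)) ?inE ?ys ?orbT //.
by apply: contraNneq xs => /inj <- //; rewrite inE ?eqxx ?ys ?orbT.
Qed.

Section Dynamics.
Variables (R : realFieldType) (I J : finType) (rho m : I -> R) (p : J -> R).
Hypothesis m_ge0 : forall i, 0 <= m i.
Hypothesis rho_m : forall i, rho i * (1 + m i) = m i.
Hypothesis p_ge0 : forall j, 0 <= p j.
Hypothesis p_sum : \sum_j p j = 1.

Notation state := {ffun I -> nat}.
Variables (step : J -> state -> state) (out : J -> state -> J) (good : pred state).
Hypothesis bad_weight : forall Q, ~~ good Q -> weight rho Q = 0.
(* [(j, Q) |-> (out j Q, step j Q)] is a weight-preserving injection: this is what makes the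
   geometric weights invariant. *)
Hypothesis step_weight : forall j Q, good Q ->
  p j * weight rho Q = p (out j Q) * weight rho (step j Q).
Hypothesis step_inj : forall j j' Q Q', good Q -> good Q' ->
  out j Q = out j' Q' -> step j Q = step j' Q' -> (j, Q) = (j', Q').
Hypothesis step_le : forall j Q i, (step j Q i <= (Q i).+1)%N.

Definition run s Q := foldl (fun Q j => step j Q) Q s.

Hypothesis run_mono : forall s Q, good Q ->
  (load (run s ([ffun=> 0%N] : state)) <= load (run s Q))%N.

Lemma sum_good K (G : state -> R) :
  \sum_(Q <- box I K) weight rho Q * G Q =
  \sum_(Q <- [seq Q <- box I K | good Q]) weight rho Q * G Q.
Proof.
rewrite (bigID good) /= [X in _ + X]big1 ?addr0 ?big_filter // => Q bQ.
by rewrite bad_weight ?mul0r.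
Qed.

(** The sum is reindexed along the weight-preserving injection. A step raises each entry by at most
    one, so the image lies in the next box, and the pairs missed by it contribute nonnegative
    terms. *)
Lemma step_subinvariant K (g : state -> R) : (forall Q, 0 <= g Q) ->
  \sum_(Q <- box I K) weight rho Q * (\sum_j p j * g (step j Q)) <=
  \sum_(Q <- box I K.+1) weight rho Q * g Q.
Proof.
move=> g0; rewrite sum_good; set sg := [seq Q <- _ | _].
pose G (x : J * state) := p x.1 * weight rho x.2 * g x.2.
pose h (x : J * state) := (out x.1 x.2, step x.1 x.2).
have -> : \sum_(Q <- sg) weight rho Q * (\sum_j p j * g (step j Q)) =
    \sum_(x <- [seq (j, Q) | j <- enum J, Q <- sg]) G (h x).
  rewrite big_allpairs /= exchange_big /= [LHS]big_seq [RHS]big_seq.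
  apply: eq_bigr => Q; rewrite mem_filter => /andP[gQ _].
  rewrite big_enum /= mulr_sumr; apply: eq_bigr => j _.
  by rewrite /G /h /= -step_weight // mulrCA mulrA.
have -> : \sum_(Q <- box I K.+1) weight rho Q * g Q =
    \sum_(x <- [seq (j, Q) | j <- enum J, Q <- box I K.+1]) G x.
  rewrite big_allpairs /= exchange_big /=; apply: eq_bigr => Q _.
  by rewrite big_enum /= /G /= -!mulr_suml p_sum mul1r.
apply: ler_sum_inj => [x|||x].
- by rewrite !mulr_ge0 ?(weight_ge0 m_ge0 rho_m).
- apply: allpairs_uniq; rewrite ?enum_uniq ?filter_uniq ?box_uniq //.
  by apply: in2W => -[? ?] [? ?] /= [-> ->].
- move=> x x' /allpairsP[[j Q] /= [_ gQ ->]] /allpairsP[[j' Q'] /= [_ gQ' ->]] [o s].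
  by move: gQ gQ'; rewrite !mem_filter => /andP[gQ _] /andP[gQ' _]; exact: step_inj.
case/allpairsP => -[j Q] /= [_ + ->]; rewrite mem_filter mem_box => /andP[_ /forallP bQ].
apply/allpairsP; exists (out j Q, step j Q); split; rewrite ?mem_enum //.
by rewrite mem_box; apply/forallP => i; rewrite ltnS (leq_trans (step_le _ _ _)).
Qed.

Lemma run_subinvariant n K (g : state -> R) : (forall Q, 0 <= g Q) ->
  \sum_(Q <- box I K) weight rho Q * Exp p n (fun s => g (run s Q)) <=
  \sum_(Q <- box I (K + n)) weight rho Q * g Q.
Proof.
move=> g0; elim: n K => [|n IH] K; first by rewrite addn0.
rewrite addnS -addSn; apply: le_trans (IH K.+1).
apply: (step_subinvariant K (g := fun Q => Exp p n (fun s => g (run s Q)))) => Q.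
exact: Exp_ge0.
Qed.

(** The empty start is compared with a start at equilibrium in a box of [mass_growth]; the factor
    [2] is the growth of the mass during [n] steps. *)
Lemma run_moment M n : (forall i, m i <= M%:R) ->
  Exp p n (fun s => (load (run s ([ffun=> 0%N] : state)))%:R ^+ 2) <= 2 * variance_bound m.
Proof.
move=> mM; have [K K0 le2] := mass_growth m_ge0 rho_m n mM.
have mK := mass_gt0 m_ge0 rho_m K0.
have v0 : 0 <= variance_bound m.
  rewrite /variance_bound !addr_ge0 ?sqr_ge0 ?sumr_ge0 // => i _.
  exact: sqr_ge0.
rewrite -(ler_pM2l mK).
pose g (Q : state) : R := (load Q)%:R ^+ 2.
have g0 Q : 0 <= g Q by exact: sqr_ge0.
apply: le_trans (_ : \sum_(Q <- box I (K + n)) weight rho Q * g Q <= _); last first.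
  apply: le_trans (load_moment m_ge0 rho_m _) _.
  by rewrite mulrCA [X in _ <= 2 * X]mulrC mulrCA ler_wpM2l.
(* By monotonicity, every good initial state ends with at least the load of the empty one. *)
apply: le_trans (run_subinvariant n K g0).
rewrite /mass mulr_suml; apply: ler_sum => Q _.
have [gQ|bQ] := boolP (good Q); last by rewrite bad_weight // !mul0r.
rewrite ler_wpM2l ?(weight_ge0 m_ge0 rho_m) //; apply: le_Exp => // s _.
by rewrite /g lerXn2r ?nnegrE ?ler0n // ler_nat run_mono.
Qed.

End Dynamics.

(** * Upper bound: row insertion *)

Section Weight.
Variables (R : realFieldType) (I : finType) (rho : I -> R).

Lemma weight_incr (b : bool) j (Q : {ffun I -> nat}) :
  weight rho [ffun i => Q i + (b && (i == j))]%N =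
  (if b then rho j else 1) * weight rho Q.
Proof.
rewrite /weight (bigD1 j) //= [in RHS](bigD1 j) //= ffunE eqxx andbT.
rewrite (eq_bigr (fun i => rho i ^+ Q i)) => [|i /negPf ij]; last by rewrite ffunE ij andbF addn0.
by case: b; rewrite ?addn1 ?addn0 ?exprS ?mul1r ?mulrA.
Qed.

Lemma weight_bad j (Q : {ffun I -> nat}) : rho j = 0 -> (0 < Q j)%N -> weight rho Q = 0.
Proof. by move=> r0 Qj; rewrite /weight (bigD1 j) //= r0 expr0n eqn0Ngt Qj mul0r. Qed.
End Weight.

Section Insertion.
Variables (d : nat) (k : 'I_d).
Notation state := {ffun 'I_d -> nat}.
Implicit Types (Q : state) (i j b : 'I_d).
Local Open Scope nat_scope.

Definition bumped j Q : option 'I_d :=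
  [pick b : 'I_d | [&& j < b, 0 < Q b & [forall i : 'I_d, (j < i < b) ==> (Q i == 0)]]].

Variant bumped_spec j Q : option 'I_d -> Type :=
  | BumpedSome b of j < b & 0 < Q b & (forall i, j < i < b -> Q i = 0) : bumped_spec j Q (Some b)
  | BumpedNone of (forall i, j < i -> Q i = 0) : bumped_spec j Q None.

Lemma bumpedP j Q : bumped_spec j Q (bumped j Q).
Proof.
rewrite /bumped; case: pickP => [b /and3P[jb Qb /forallP H]|none].
  by constructor => // i ji; apply/eqP; apply: implyP (H i) ji.
constructor => i ji; apply/eqP; apply: contraT; rewrite -lt0n => Qi.
pose P i := (j < i) && (0 < Q i).
have Pi : P i by rewrite /P ji.
case: (arg_minnP (fun i : 'I_d => i : nat) Pi) => b /andP[jb Qb] bmin.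
have := none b; rewrite jb Qb /= => /negP[]; apply/forallP => l.
apply/implyP => /andP[jl lb]; apply: contraT; rewrite -lt0n => Ql.
by have := bmin l; rewrite /P jl Ql => /(_ isT); rewrite leqNgt lb.
Qed.

(* Row insertion: the row contains [Q i] letters [i > k]; letters below [k] are ignored. *)
Definition insert j Q : state :=
  if j < k then Q else
  [ffun i => Q i + ((k < j) && (i == j)) - (bumped j Q == Some i)].

(** In equilibrium a letter [i > k] of the row weighs [p i / p k], so trading [j] for the bumped
    letter, or for [k] if nothing is bumped, preserves the weight. *)
Definition insert_out j Q : 'I_d := if j < k then j else odflt k (bumped j Q).

Definition row_good Q := [forall i : 'I_d, (i <= k) ==> (Q i == 0)].

Definition psum (l : nat) Q := \sum_(i : 'I_d | i <= l) Q i.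

Lemma row_good0 : row_good [ffun=> 0].
Proof. by apply/forallP => i; rewrite ffunE eqxx implybT. Qed.

Lemma insert_good j Q : row_good Q -> row_good (insert j Q).
Proof.
move=> /forallP gQ; apply/forallP => i; apply/implyP => ik; rewrite /insert.
have Qi : Q i = 0 by apply/eqP; apply: implyP (gQ i) ik.
case: ifP => [_|_]; first by rewrite Qi.
by rewrite ffunE Qi; case: (i =P j) => [<-|_]; rewrite ?andbF // ltnNge ik.
Qed.

Lemma insertE j Q i : k <= j ->
  insert j Q i + (bumped j Q == Some i) = Q i + ((k < j) && (i == j)).
Proof.
move=> kj; rewrite /insert ltnNge kj /= ffunE subnK //.
case: eqP => // E; case: bumpedP E => [b _ Qb _ [<-]|//].
by apply: leq_trans Qb _; apply: leq_addr.
Qed.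

Lemma sum_pred1 l b : \sum_(i : 'I_d | i <= l) (Some b == Some i) = (b <= l).
Proof.
rewrite big_mkcond /= (bigD1 b) //= eqxx big1 ?addn0; first by case: (_ <= _).
by move=> i ib; case: ifP => // _; case: eqP => // -[e]; rewrite e eqxx in ib.
Qed.

(** From an empty row, [psum l] plus the number of letters [k] read is the length [L l] of the
    longest weakly increasing subsequence with letters in [[k, l]]. A new letter [j] changes [L l]
    to the maximum of [L l] and [L j + 1] for [l >= j], a form that is visibly monotone. *)
Lemma psum_insert l j Q : row_good Q -> k <= j -> k <= l ->
  psum l (insert j Q) + (j == k) =
  if l < j then psum l Q else maxn (psum l Q) (psum j Q).+1.
Proof.
move=> /forallP gQ kj kl.
have sumE : psum l (insert j Q) + \sum_(i : 'I_d | i <= l) (bumped j Q == Some i) =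
    psum l Q + ((k < j) && (j <= l)).
  rewrite /psum -big_split (eq_bigr _ (fun i _ => insertE Q i kj)) big_split /=; congr (_ + _).
  case: (k < j); last by rewrite big1.
  by rewrite -sum_pred1; apply: eq_bigr => i _; rewrite eq_sym.
have jk : (j == k) = ~~ (k < j) by rewrite -leqNgt -val_eqE /= eqn_leq kj andbT.
have psumS l' : j <= l' -> psum l' Q = psum j Q + \sum_(i : 'I_d | j < i <= l') Q i.
  move=> jl; rewrite /psum (bigID (fun i : 'I_d => i <= j)) /=; congr (_ + _); apply: eq_bigl => i.
    by case: (leqP i j) => [/leq_trans ->|]; rewrite ?andbF.
  by rewrite -ltnNge andbC.
have k0 : k = j -> psum j Q = 0.
  move=> e; rewrite /psum big1 // => i ij; apply/eqP; apply: implyP (gQ i) _.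
  by rewrite e.
move: sumE; case: bumpedP => [b jb Qb Q0|Q0].
  rewrite sum_pred1; case: (ltnP l j) => lj.
    by rewrite jk (_ : (b <= l) = false); lia.
  case: (leqP b l) => bl.
    have : psum j Q < psum l Q.
      rewrite (psumS l) // -[X in X < _]addn0 ltn_add2l (bigD1 b) ?jb ?bl //=.
      by rewrite addn_gt0 Qb.
    by rewrite jk; lia.
  have : psum l Q = psum j Q.
    by rewrite (psumS l) // big1 ?addn0 // => i /andP[ji il]; apply: Q0; lia.
  by rewrite jk; lia.
rewrite big1 //; case: (ltnP l j) => lj; first by rewrite jk; lia.
have : psum l Q = psum j Q.
  by rewrite (psumS l) // big1 ?addn0 // => i /andP[ji il]; apply: Q0.
by rewrite jk; lia.
Qed.

(** The output determines the bumped letter; the new row then determines the inserted letter, hence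
    the old row. *)
Lemma insert_inj j j' Q Q' : row_good Q -> row_good Q' ->
  insert_out j Q = insert_out j' Q' -> insert j Q = insert j' Q' -> (j, Q) = (j', Q').
Proof.
have kout j1 Q1 : k <= j1 -> k <= insert_out j1 Q1.
  move=> kj; rewrite /insert_out ltnNge kj /=.
  by case: bumpedP => //= b jb _ _; lia.
have bump_eq j1 j2 Q1 Q2 : k <= j1 -> k <= j2 ->
    insert_out j1 Q1 = insert_out j2 Q2 -> bumped j1 Q1 = bumped j2 Q2.
  move=> k1 k2; rewrite /insert_out !ltnNge k1 k2 /=.
  case: bumpedP => [b jb _ _|_]; case: bumpedP => [b' jb' _ _|_] //= e; rewrite ?e //.
    by move: jb; rewrite e; lia.
  by move: jb'; rewrite -e; lia.
(* The letter [j2] lies strictly between [j1] and the common bumped letter, if any, so it is absent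
   from the first new row; the second one contains it. *)
have nlt j1 j2 Q1 Q2 : k <= j1 -> j1 < j2 ->
    insert_out j1 Q1 = insert_out j2 Q2 -> insert j1 Q1 = insert j2 Q2 -> False.
  move=> k1 j12 eo es; have k2 : k <= j2 by lia.
  have eb := bump_eq _ _ _ _ k1 k2 eo.
  have := insertE Q1 j2 k1; have := insertE Q2 j2 k2; rewrite -es -eb eqxx.
  have -> : (j2 == j1) = false by rewrite -val_eqE /=; lia.
  case: bumpedP eb => [b jb Qb Q0|Q0]; case: bumpedP => [b' jb' _ _|_] //.
    move=> [e]; rewrite -e in jb'.
    have -> : (Some b == Some j2) = false.
      by apply/eqP => -[e']; move: jb'; rewrite e' ltnn.
    by rewrite (Q0 j2) ?j12 //; lia.
  by rewrite (Q0 j2 j12); lia.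
move=> gQ gQ' eo es.
case: (ltnP j k) => jk; case: (ltnP j' k) => jk'.
- by move: eo es; rewrite /insert_out /insert jk jk' => -> ->.
- by have := kout _ Q' jk'; rewrite -eo /insert_out jk leqNgt jk.
- by have := kout _ Q jk; rewrite eo /insert_out jk' leqNgt jk'.
case: (ltngtP j j') => [lt|lt|/val_inj ejj].
- by case: (nlt _ _ _ _ jk lt eo es).
- by case: (nlt _ _ _ _ jk' lt (esym eo) (esym es)).
subst j'; congr (_, _); apply/ffunP => i.
have := insertE Q i jk; have := insertE Q' i jk; rewrite es (bump_eq _ _ _ _ jk jk eo).
by move=> -> /addIn->.
Qed.

Lemma insert_le j Q i : insert j Q i <= (Q i).+1.
Proof.
rewrite /insert; case: ifP => // _; rewrite ffunE.
by apply: leq_trans (leq_subr _ _) _; case: (_ && _); lia.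
Qed.

Lemma psum_insert_mono j Q Q' l : row_good Q -> row_good Q' ->
  (forall l, k <= l -> psum l Q <= psum l Q') -> k <= l ->
  psum l (insert j Q) <= psum l (insert j Q').
Proof.
move=> gQ gQ' le kl; case: (ltnP j k) => jk; first by rewrite /insert jk; apply: le.
rewrite -(leq_add2r (j == k)) !psum_insert //.
have := le _ kl; have := le _ jk; case: (l < j); lia.
Qed.

Lemma load_psum Q : load Q = psum d Q.
Proof. by apply: eq_bigl => i; rewrite ltnW. Qed.

Lemma run_insert_mono s Q : row_good Q ->
  load (run insert s ([ffun=> 0] : state)) <= load (run insert s Q).
Proof.
move=> gQ; have kd : k <= d by rewrite ltnW.
have : forall l, k <= l -> psum l ([ffun=> 0] : state) <= psum l Q.
  by move=> l _; apply: leq_sum => i _; rewrite ffunE.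
have := row_good0; move: gQ; move: Q ([ffun=> 0] : state).
elim: s => [|j s IH] Q Q0 gQ gQ0 le /=; first by rewrite !load_psum le.
by apply: IH; rewrite ?insert_good // => l kl; apply: psum_insert_mono.
Qed.

Lemma run_insert_good s Q : row_good Q -> row_good (run insert s Q).
Proof. by elim: s Q => //= j s IH Q gQ; apply/IH/insert_good. Qed.

(** Induction on the last letter. If it is chosen, the earlier chosen letters are at most [a t], so
    the induction hypothesis applies with [a t] for [l], and the successor in [psum_insert] pays for
    the new letter. *)
Lemma chain_psum (T : Type) (z : seq T) (a : T -> 'I_d) (f : pred T) l :
  k <= l -> sorted leq [seq nat_of_ord (a t) | t <- z & f t] ->
  all (fun t => f t ==> (k <= a t <= l)) z ->
  count f z <= count (fun t => a t == k) z + psum l (run insert (map a z) [ffun=> 0]).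
Proof.
move=> + st; move: st; rewrite (sorted_pairwise leq_trans).
elim/last_ind: z l => [|z t IH] l //=.
have crc q : count q (rcons z t) = count q z + q t by rewrite -cats1 count_cat /= addn0.
rewrite filter_rcons map_rcons !all_rcons /run foldl_rcons -/(run _ _ _) !crc.
set Q := run _ _ _; have gQ : row_good Q by apply/run_insert_good/row_good0.
have step l' : k <= a t -> k <= l' ->
    psum l' Q <= psum l' (insert (a t) Q) + (a t == k).
  by move=> kt kl'; rewrite psum_insert //; case: ifP; lia.
case: (boolP (f t)) => ft /=.
  rewrite map_rcons pairwise_rcons => /andP[le pw] kl /andP[/andP[kt tl] allz].
  have := IH (a t) pw kt; rewrite -/Q => IHt.
  have := psum_insert gQ kt kl; rewrite ltnNge tl /= => E.
  suff : count f z <= count (fun t => a t == k) z + psum (a t) Q by lia.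
  apply: IHt; move: le allz; rewrite all_map all_filter => le allz.
  apply: sub_all (_ : all (predI _ _) z); last first.
    by rewrite all_predI; apply/andP; split; [exact: le | exact: allz].
  by move=> t' /andP[/implyP /= h1 /implyP h2]; apply/implyP => ft'; have := h1 ft'; have := h2 ft'; lia.
move=> pw kl allz; have := IH l pw kl allz; rewrite -/Q => IHl.
case: (leqP k (a t)) => kt; first by have := step l kt kl; lia.
have -> : insert (a t) Q = Q by rewrite /insert kt.
by lia.
Qed.

(** Turning a marked letter into [k] may remove it from the chain and add one to the number of
    letters [k]: hence twice the number of marks. *)
Lemma chain_load (T : eqType) (z : seq T) (a : T -> 'I_d) (c f : pred T) :
  sorted leq [seq nat_of_ord (a t) | t <- z & f t] ->
  all (fun t => f t ==> (k <= a t)) z ->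
  count f z <= count (fun t => a t == k) z +
    (load (run insert [seq if c t then k else a t | t <- z] [ffun=> 0]) + 2 * count c z).
Proof.
move=> st al; pose a' t := if c t then k else a t; pose f' t := f t && ~~ c t.
have kd : k <= d by rewrite ltnW.
have : count f' z <= count (fun t => a' t == k) z + psum d (run insert (map a' z) [ffun=> 0]).
  apply: chain_psum => //; last first.
    by apply: sub_all al => t; rewrite /f' /a'; case: (c t) => //=; case: (f t) => //= ->; rewrite ltnW.
  have -> : [seq nat_of_ord (a' t) | t <- z & f' t] = [seq nat_of_ord (a t) | t <- z & f' t].
    elim: z {st al} => //= t z IHz; case: ifP => //= ft; rewrite IHz; congr (_ :: _).
    by move: ft; rewrite /f' /a' => /andP[_ /negPf->].
  apply: (subseq_sorted leq_trans) st; apply: map_subseq.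
  rewrite (_ : filter f' z = filter (predC c) (filter f z)) ?filter_subseq //.
  by rewrite -filter_predI; apply: eq_filter => t; rewrite /= andbC.
rewrite -load_psum -/a'.
have : count f z <= count f' z + count c z.
  rewrite -(count_predUI f' c); apply: leq_trans (leq_addr _ _); apply: sub_count => t /=.
  by rewrite /f'; case: (c t); rewrite ?orbT ?andbT ?orbF.
have : count (fun t => a' t == k) z <= count (fun t => a t == k) z + count c z.
  rewrite -(count_predUI _ c); apply: leq_trans (leq_addr _ _); apply: sub_count => t /=.
  by rewrite /a'; case: (c t); rewrite ?orbT ?orbF.
lia.
Qed.
End Insertion.

(** * Lower bound: queues in series *)

Section Tandem.
Variables (d : nat) (k : 'I_d).
Notation state := {ffun 'I_d -> nat}.
Implicit Types (Q : state) (i j b : 'I_d) (o : option 'I_d).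
Local Open Scope nat_scope.

Definition active j Q := (j == k) || ((j < k) && (0 < Q j)).

(* Queues in series: letter [k] is an arrival at server [k - 1], a letter [j < k] moves a
   customer from server [j] to server [j - 1], and server 0 feeds the exit. *)
Definition serve o Q : state :=
  if o is Some j then
    if active j Q then [ffun i => Q i - ((j < k) && (i == j)) + (i.+1 == j)] else Q
  else Q.

Definition next_server j : 'I_d := odflt k [pick i : 'I_d | i.+1 == j].

(** The letter of the time-reversed queues, as in Burke's theorem: an active letter outputs the
    server that receives the customer, or [k] when the customer leaves. *)
Definition serve_out o Q : option 'I_d :=
  if o is Some j then if active j Q then Some (next_server j) else Some j else None.

Definition queue_good Q := [forall i : 'I_d, (k <= i) ==> (Q i == 0)].

Definition tsum (l : nat) Q := \sum_(i : 'I_d | l <= i) Q i.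

Lemma queue_goodP Q : reflect (forall i, k <= i -> Q i = 0) (queue_good Q).
Proof.
apply: (iffP forallP) => [H i ki|H i]; first by apply/eqP; apply: implyP (H i) ki.
by apply/implyP => /H ->.
Qed.

Variant next_server_spec j : 'I_d -> Type :=
  | NextExit of j = 0 :> nat : next_server_spec j k
  | NextServer i of i.+1 = j : next_server_spec j i.

Lemma next_serverP j : next_server_spec j (next_server j).
Proof.
rewrite /next_server; case: pickP => [i /eqP|none]; first exact: NextServer.
apply: NextExit; case: j none => -[//|j] lt none.
by have := none (Ordinal (ltnW lt)); rewrite eqxx.
Qed.

Lemma serveE j Q i : active j Q ->
  serve (Some j) Q i + ((j < k) && (i == j)) = Q i + (i.+1 == j).
Proof.
move=> act; rewrite /serve act ffunE.
have : ((j < k) && (i == j)) <= Q i.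
  by case: eqP => [->|]; rewrite ?andbF // andbT; move: act; rewrite /active -val_eqE /=; lia.
by move=> le; rewrite addnAC subnK.
Qed.

Lemma active_le j Q : active j Q -> j <= k.
Proof. by case/orP => [/eqP->//|/andP[/ltnW]]. Qed.

Lemma serve_inj o o' Q Q' : queue_good Q -> queue_good Q' ->
  serve_out o Q = serve_out o' Q' -> serve o Q = serve o' Q' -> (o, Q) = (o', Q').
Proof.
(* After an active letter, its output is [k] or a server that has just received a customer, hence is
   active in the new state; an inactive letter outputs itself and changes nothing. *)
have mixed j j' Q1 Q2 : active j Q1 -> ~~ active j' Q2 ->
    serve_out (Some j) Q1 = serve_out (Some j') Q2 ->
    serve (Some j) Q1 = serve (Some j') Q2 -> False.
  move=> act nact; rewrite /serve_out act (negPf nact) => -[ep] es.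
  have es' : serve (Some j) Q1 = Q2 by rewrite es /serve (negPf nact).
  case: next_serverP ep => [j0|i ij] e; first by move: nact; rewrite -e /active eqxx.
  have := serveE i act; rewrite es' ij eqxx.
  have -> : (i == j) = false by rewrite -val_eqE /=; lia.
  by move: nact; rewrite -e /active; have := active_le act; lia.
move=> gQ gQ'; case: o => [j|]; case: o' => [j'|] /=; last by move=> _ ->.
- have [act|nact] := boolP (active j Q); have [act'|nact'] := boolP (active j' Q').
  + move=> eo es; have ej : j = j'.
      move: eo => -[]; have := active_le act; have := active_le act'.
      case: next_serverP => [j0|i ij]; case: next_serverP => [j0'|i' ij'] le le' e; apply: val_inj => /=.
      * by rewrite j0 j0'.
      * by rewrite -e in ij'; lia.
      * by rewrite e in ij; lia.
      * by rewrite -ij -ij' e.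
    subst j'; congr (_, _); apply/ffunP => i.
    have := serveE i act; have := serveE i act'; rewrite /serve act act' es.
    by move=> -> /addIn->.
  + by move=> eo es; case: (mixed _ _ _ _ act nact'); rewrite /serve_out /serve act (negPf nact').
  + by move=> eo es; case: (mixed _ _ _ _ act' nact); rewrite /serve_out /serve act' (negPf nact).
  + by move=> [->] ->.
- by case: ifP.
- by case: ifP.
Qed.

Lemma serve_le o Q i : serve o Q i <= (Q i).+1.
Proof.
case: o => [j|] //=; case: ifP => // _; rewrite ffunE.
by apply: leq_trans (leq_add (leq_subr _ _) (leq_b1 _)) _; rewrite addn1.
Qed.

Lemma tsumS j Q : tsum j Q = Q j + tsum j.+1 Q.
Proof.
rewrite /tsum (bigD1 j) //=; congr (_ + _); apply: eq_bigl => i.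
by rewrite ltn_neqAle eq_sym -val_eqE andbC.
Qed.

Lemma tsum_serve_active l j Q : active j Q ->
  tsum l (serve (Some j) Q) + ((j < k) && (l <= j)) = tsum l Q + (l < j).
Proof.
move=> act.
have sum1 (m : nat) (P : pred 'I_d) (e : 'I_d) : (forall i, P i = (i == e)) ->
    \sum_(i : 'I_d | m <= i) P i = (m <= e).
  move=> Pe; rewrite big_mkcond (bigD1 e) //= Pe eqxx big1 ?addn0; first by case: (_ <= _).
  by move=> i /negPf ie; rewrite Pe ie if_same.
have : \sum_(i : 'I_d | l <= i) (serve (Some j) Q i + ((j < k) && (i == j))) =
    \sum_(i : 'I_d | l <= i) (Q i + (i.+1 == j)).
  by apply: eq_bigr => i _; exact: serveE.
rewrite !big_split /= -!/(tsum _ _).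
have -> : \sum_(i : 'I_d | l <= i) ((j < k) && (i == j)) = (j < k) && (l <= j).
  case: (j < k); last by rewrite big1.
  exact: (sum1 l (fun i => i == j) j).
move=> ->; congr (_ + _); case: (next_serverP j) => [j0|i ij].
  by rewrite j0 ltn0 big1.
rewrite (sum1 l (fun i => i.+1 == j) i) ?ij //; first by rewrite -ij.
by move=> i'; rewrite -ij eqSS.
Qed.

(** The maximum expresses that an empty server does nothing, and makes the update monotone in the
    family of all [tsum l]. *)
Lemma tsum_serve l j Q :
  tsum l (serve (Some j) Q) =
  if j == k then tsum l Q + (l < k)
  else if (j < k) && (l == j) then maxn (tsum l.+1 Q) (tsum l Q).-1 else tsum l Q.
Proof.
have [act|nact] := boolP (active j Q).
  have := tsum_serve_active l act; move: act; rewrite /active.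
  case: eqP => [->|_] /=; first by rewrite ltnn addn0.
  case/andP => -> Qj /=; case: eqP => [->|] ; last by lia.
  by rewrite leqnn ltnn [tsum j Q]tsumS; lia.
rewrite /serve (negPf nact); move: nact; rewrite /active negb_or => /andP[/negPf->].
case: ltnP => //= _ Qj; case: eqP => [->|//].
by rewrite [tsum j Q]tsumS; lia.
Qed.

Lemma tsum_serve_mono o Q Q' : (forall l, tsum l Q <= tsum l Q') ->
  forall l, tsum l (serve o Q) <= tsum l (serve o Q').
Proof.
case: o => [j|] le l //; rewrite !tsum_serve; have := le l; have := le l.+1.
case: ifP => _; first by lia.
by case: ifP => _; lia.
Qed.

Lemma run_serve_mono s Q :
  load (run serve s ([ffun=> 0] : state)) <= load (run serve s Q).
Proof.
have loadE Q1 : load Q1 = tsum 0 Q1 by [].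
have : forall l, tsum l ([ffun=> 0] : state) <= tsum l Q.
  by move=> l; apply: leq_sum => i _; rewrite ffunE.
move: Q ([ffun=> 0] : state).
elim: s => [|j s IH] Q Q0 le /=; first by rewrite !loadE le.
by apply: IH; apply: tsum_serve_mono.
Qed.

(** A customer passes below the path only by a letter that the path meets, and the path never rises.
    So each arrival is charged to such a letter, or is still at or above the path, hence at a server
    [>= l]. *)
Lemma path_tsum (T : Type) (z : seq T) (a : T -> option 'I_d) (u : T -> nat) l :
  sorted geq (map u z) -> all (fun t => l <= u t <= k) z ->
  count (fun t => a t == Some k) z <=
  count (fun t => oapp (fun j : 'I_d => j == u t :> nat) false (a t)) z +
  tsum l (run serve (map a z) [ffun=> 0]).
Proof.
rewrite (sorted_pairwise (rev_trans leq_trans)).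
elim/last_ind: z l => [|z t IH] l //=.
have crc q : count q (rcons z t) = count q z + q t by rewrite -cats1 count_cat /= addn0.
rewrite !map_rcons pairwise_rcons all_rcons /run foldl_rcons -/(run _ _ _) !crc.
move=> /andP[le pw] /andP[/andP[lt tk] al].
set Q := run _ _ _; set G := count (fun t => oapp _ _ _) z.
have IHl := IH l pw al.
(* Needed when server [l] works while the path is strictly above [l]: [tsum l] may drop with no
   letter met, but it stays at least [tsum l.+1]. *)
have IHS : l < u t -> count (fun t => a t == Some k) z <= G + tsum l.+1 Q.
  move=> lu; apply: IH => //; move: le; rewrite all_map => le.
  apply: sub_all (_ : all (predI _ _) z); last first.
    by rewrite all_predI; apply/andP; split; [exact: le | exact: al].
  by move=> t' /= /andP[h1 /andP[_ h2]]; rewrite h2 andbT; apply: leq_trans h1.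
rewrite -/Q -/G in IHl; case: (a t) => [j|]; last by rewrite /= !addn0.
rewrite [serve _ _ in X in _ <= X]/(serve _ _) tsum_serve /=.
have -> : (Some j == Some k) = (j == k) by [].
case: eqP => [->|jk]; first by case: (ltngtP (u t) k) => ut; lia.
case: andP => [[jk' /eqP lj]|_] /=; last by lia.
by case: (ltngtP (u t) l) => ut; [lia | have := IHS ut; lia | lia].
Qed.

(** Erasing a marked letter [k] suppresses one arrival, so each mark costs at most one. *)
Lemma path_load (T : Type) (z : seq T) (a : T -> 'I_d) (c : pred T) (u : T -> nat) :
  sorted geq (map u z) -> all (fun t => u t <= k) z ->
  count (fun t => a t == k) z <=
  count (fun t => a t == u t :> nat) z +
  (load (run serve [seq if c t && (a t == k) then None else Some (a t) | t <- z] [ffun=> 0])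
   + count c z).
Proof.
move=> st al; pose a' t := if c t && (a t == k) then None else Some (a t).
have := @path_tsum T z a' u 0 st al.
have : count (fun t => a t == k) z <= count (fun t => a' t == Some k) z + count c z.
  rewrite -(count_predUI _ c); apply: leq_trans (leq_addr _ _); apply: sub_count => t /=.
  by rewrite /a'; case: (c t); rewrite ?orbT ?orbF.
have : count (fun t => oapp (fun j : 'I_d => j == u t :> nat) false (a' t)) z <=
    count (fun t => a t == u t :> nat) z.
  by apply: sub_count => t; rewrite /a'; case: ifP.
have loadE Q : load Q = tsum 0 Q by [].
by rewrite loadE -/a'; lia.
Qed.
End Tandem.

(** * Second moments of the perturbed queues *)

(** The number of queues does not enter: with [x = \sum_i y i], the two quadratic terms are at most
    [(x + A) * x * M ^+ 2], and [x + A <= 1]. *)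
Lemma variance_bound_le (R : realFieldType) (I : finType) (m y : I -> R) (A M : R) :
  (forall i, 0 <= m i <= y i * M) -> (forall i, y i <= A) -> 0 <= M ->
  \sum_i y i + A <= 1 -> 0 <= A -> variance_bound m <= M ^+ 2 + M.
Proof.
move=> mb yA M0 sA A0; rewrite /variance_bound.
set x := \sum_i y i in sA *.
have s0 : 0 <= \sum_i m i by apply: sumr_ge0 => i _; case/andP: (mb i).
have s1 : \sum_i m i <= x * M.
  by rewrite mulr_suml; apply: ler_sum => i _; case/andP: (mb i).
have s2 : \sum_i m i ^+ 2 <= A * M * (x * M).
  rewrite [x * M]mulr_suml mulr_sumr; apply: ler_sum => i _.
  have /andP[m0 m1] := mb i; rewrite expr2 ler_pM //.
  by apply: le_trans m1 _; rewrite ler_wpM2r.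
have x0 : 0 <= x * M by apply: le_trans s1.
have sq : (\sum_i m i) ^+ 2 <= (x * M) ^+ 2 by rewrite lerXn2r.
have xM : x * M <= M by rewrite ler_piMl //; lra.
have AM : A * M <= M - x * M by rewrite -{2}(mul1r M) -mulrBl ler_wpM2r //; lra.
have : A * M * (x * M) <= (M - x * M) * (x * M) by rewrite ler_wpM2r.
have : x * M * M <= M * M by rewrite ler_wpM2r.
by rewrite !expr2 in sq *; lra.
Qed.

Lemma Exp_count_sqr (R : realFieldType) (J : finType) (p : J -> R) (f : pred J) n e :
  (forall j, 0 <= p j) -> \sum_j p j = 1 -> \sum_(j | f j) p j <= e ->
  Exp p n (fun s => (count f s)%:R ^+ 2) <= n%:R * e + (n%:R * e) ^+ 2.
Proof.
move=> p0 p1 fe; pose g j : R := (f j)%:R.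
rewrite (eq_Exp p n (G := fun s => (\sum_(x <- s) g x) ^+ 2)) => [|s]; last first.
  rewrite -sum1_count natr_sum big_mkcond; congr (_ ^+ 2).
  by apply: eq_bigr => x _; rewrite /g; case: (f x).
have E : \sum_j p j * g j = \sum_(j | f j) p j.
  by rewrite [RHS]big_mkcond; apply: eq_bigr => j _; rewrite /g; case: (f j); rewrite ?mulr1 ?mulr0.
rewrite Exp_sum_sqr // (eq_bigr (fun j => p j * g j)) => [|j _]; last first.
  by rewrite /g; case: (f j); rewrite ?expr0n ?expr1n.
rewrite E; have S0 : 0 <= \sum_(j | f j) p j by apply: sumr_ge0.
rewrite lerD ?ler_wpM2l // exprMn ler_pM ?sqr_ge0 ?ler0n //.
  by rewrite -natrX ler_nat -mulnn leq_mul2l leq_pred orbT.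
by rewrite lerXn2r // nnegrE // (le_trans S0).
Qed.

Section Row.
Variables (R : realFieldType) (d : nat) (alpha : 'I_d -> R).
Hypothesis alpha_ge0 : forall i, 0 <= alpha i.
Hypothesis alpha_sum1 : \sum_i alpha i = 1.
Hypothesis alpha_noninc : forall i j : 'I_d, (i <= j)%N -> alpha j <= alpha i.
Variable k : 'I_d.

(* A letter together with an independent coin, which marks the letters to be perturbed. *)
Definition coin_prob (t : R) (x : 'I_d * bool) : R := alpha x.1 * (if x.2 then t else 1 - t).

Lemma sum_coin (t : R) (F : 'I_d * bool -> R) :
  \sum_x coin_prob t x * F x =
  \sum_i alpha i * (t * F (i, true) + (1 - t) * F (i, false)).
Proof.
transitivity (\sum_i \sum_b coin_prob t (i, b) * F (i, b)).
  by rewrite pair_bigA; apply: eq_bigr => -[].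
by apply: eq_bigr => i _; rewrite big_bool /coin_prob /=; ring.
Qed.

Lemma sum_coin_cond (t : R) (P : pred ('I_d * bool)) :
  \sum_(x | P x) coin_prob t x =
  \sum_i alpha i * (t * (P (i, true))%:R + (1 - t) * (P (i, false))%:R).
Proof.
rewrite -(sum_coin t (fun x => (P x)%:R)) big_mkcond; apply: eq_bigr => x _.
by case: (P x); rewrite ?mulr1 ?mulr0.
Qed.

Lemma coin_prob_ge0 t x : 0 <= t <= 1 -> 0 <= coin_prob t x.
Proof. by move=> t01; rewrite /coin_prob mulr_ge0 //; case: ifP => _; lra. Qed.

Lemma coin_prob_sum t : \sum_x coin_prob t x = 1.
Proof.
rewrite -alpha_sum1 (sum_coin_cond t xpredT); apply: eq_bigr => i _.
by rewrite !mulr1; ring.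
Qed.

Lemma coin_prob_fst t y : \sum_(x | x.1 == y) coin_prob t x = alpha y.
Proof.
rewrite (sum_coin_cond t (fun x => x.1 == y)) (bigD1 y) //= eqxx big1 => [|i /negPf->].
  by rewrite !mulr1; ring.
by rewrite !mulr0; ring.
Qed.

Lemma sum_alpha_pred (y : 'I_d) : \sum_i alpha i * (i == y)%:R = alpha y.
Proof.
rewrite (bigD1 y) //= eqxx mulr1 big1 ?addr0 // => i /negPf->.
by rewrite mulr0.
Qed.

(** Turning letters into [k] with probability [e = 1 / M] creates a gap [p k - p j >= e] for
    [j > k]. The equilibrium means [p j / (p k - p j)] are then at most [alpha j * M]. *)
Lemma insertion_moment (M n : nat) : (0 < M)%N ->
  Exp (coin_prob M%:R^-1) n (fun s =>
    (load (run (insert k) [seq if x.2 then k else x.1 | x <- s] [ffun=> 0%N]))%:R ^+ 2)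
  <= 2 * (M%:R ^+ 2 + M%:R).
Proof.
move=> M0; set e := M%:R^-1.
have MR : 0 < M%:R :> R by rewrite ltr0n.
have eM : e * M%:R = 1 by rewrite mulVf ?gt_eqF.
have e0 : 0 < e by rewrite invr_gt0.
have e1 : e <= 1 by rewrite invf_le1 // ler1n.
pose p j := (1 - e) * alpha j + e * (j == k)%:R.
have pk : p k = (1 - e) * alpha k + e by rewrite /p eqxx mulr1.
have p0 j : 0 <= p j.
  by rewrite /p addr_ge0 ?mulr_ge0 ?ler0n ?subr_ge0 // ltW.
have pj (j : 'I_d) : (k < j)%N -> p j = (1 - e) * alpha j.
  by move=> kj; rewrite /p -val_eqE /= gtn_eqF // mulr0 addr0.
have gap (j : 'I_d) : (k < j)%N -> e <= p k - p j.
  move=> kj; rewrite pk pj //; have := alpha_noninc (ltnW kj).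
  have e1' : 0 <= 1 - e by lra.
  by move=> /(ler_wpM2l e1'); lra.
have pk0 : 0 < p k by rewrite pk; apply: ltr_wpDl => //; rewrite mulr_ge0 //; lra.
have p1 : \sum_j p j = 1.
  rewrite /p big_split /= -!mulr_sumr alpha_sum1 (bigD1 k) //= eqxx big1 => [|i /negPf->//].
  by rewrite addr0 !mulr1 subrK.
rewrite (Exp_map (p := p) n (fun s => (load (run (insert k) s [ffun=> 0%N]))%:R ^+ 2)); last first.
  move=> y; rewrite (sum_coin_cond e (fun x => (if x.2 then k else x.1) == y)) /=.
  rewrite (eq_bigr (fun i => alpha i * (e * (k == y)%:R) + (1 - e) * (alpha i * (i == y)%:R))).
    by rewrite big_split /= -mulr_suml -mulr_sumr alpha_sum1 sum_alpha_pred mul1r addrC eq_sym.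
  by move=> i _; ring.
(* The ratio [0] for [j <= k] gives weight zero to the rows violating [row_good]. *)
pose rho (j : 'I_d) := if (k < j)%N then p j / p k else 0.
pose m (j : 'I_d) := if (k < j)%N then p j / (p k - p j) else 0.
have m0 j : 0 <= m j.
  rewrite /m; case: ifP => // kj; rewrite divr_ge0 // ltW //.
  exact: lt_le_trans (gap j kj).
have rho_m j : rho j * (1 + m j) = m j.
  rewrite /rho /m; case: ifP => [kj|_]; last by rewrite mul0r.
  have g0 : p k - p j != 0 by rewrite gt_eqF // (lt_le_trans e0) ?gap.
  by field; rewrite g0 gt_eqF.
have m_le j : m j <= (if (k < j)%N then alpha j else 0) * M%:R.
  rewrite /m; case: ifP => [kj|_]; last by rewrite mul0r.
  have g0 : 0 < p k - p j by rewrite (lt_le_trans e0) ?gap.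
  rewrite ler_pdivrMr // (le_trans (y := alpha j)) //.
    by rewrite pj // ler_piMl //; lra.
  rewrite -mulrA ler_peMr // -[X in X <= _]eM mulrC ler_wpM2l ?ler0n ?gap //.
have y_le (j : 'I_d) : (if (k < j)%N then alpha j else 0) <= alpha k.
  by case: ifP => // kj; apply/alpha_noninc/ltnW.
apply: le_trans (_ : 2 * variance_bound m <= _); last first.
  rewrite ler_wpM2l //.
  apply: (@variance_bound_le _ _ _
    (fun j : 'I_d => if (k < j)%N then alpha j else 0) (alpha k)) => //.
    by move=> j; rewrite m0 m_le.
  rewrite -alpha_sum1 (bigD1 k) //= ltnn add0r [X in _ <= X](bigD1 k) //= [X in X <= _]addrC lerD2l.
  by apply: ler_sum => i _; case: ifP.
apply: (@run_moment R _ _ rho m p m0 rho_m p0 p1 (insert k) (insert_out k) (row_good k) _ _ _ _ _ M).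
- move=> Q; rewrite negb_forall => /existsP[i]; rewrite negb_imply -lt0n => /andP[ik Qi].
  by apply: (weight_bad (j := i)) => //; rewrite /rho ltnNge ik.
- move=> j Q gQ; rewrite /insert_out; case: (ltnP j k) => jk; first by rewrite /insert jk.
  (* Both sides are the weight of the row that holds the new letter and still holds the bumped
     one. *)
  have E : weight rho (insert k j Q) * (if bumped j Q is Some b then rho b else 1) =
      (if (k < j)%N then rho j else 1) * weight rho Q.
    rewrite -weight_incr mulrC.
    have -> : [ffun i => (Q i + ((k < j) && (i == j)))%N] =
        [ffun i => (insert k j Q i + (bumped j Q == Some i))%N].
      by apply/ffunP => i; rewrite !ffunE insertE.
    case: (bumped j Q) => [b|].
      rewrite -(weight_incr rho true b); congr (weight rho _); apply/ffunP => i; rewrite !ffunE /=.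
      by rewrite -[i == b]/(Some i == Some b) eq_sym.
    by rewrite mul1r; congr (weight rho _); apply/ffunP => i; rewrite ffunE addn0.
  have pout : p (odflt k (bumped j Q)) = p k * (if bumped j Q is Some b then rho b else 1).
    case: bumpedP => [b jb _ _|_] /=; last by rewrite mulr1.
    by rewrite /rho (leq_ltn_trans jk jb) mulrC divfK // gt_eqF.
  rewrite pout -mulrA [X in _ = _ * X]mulrC E mulrA; congr (_ * _).
  case: ltnP => [kj|jk']; first by rewrite /rho kj mulrC divfK // gt_eqF.
  by rewrite mulr1; congr p; apply: val_inj => /=; apply/eqP; rewrite eqn_leq jk jk'.
- exact: insert_inj.
- exact: insert_le.
- by move=> s Q; apply: run_insert_mono.
move=> i; apply: le_trans (m_le i) _; rewrite ler_piMl ?ler0n //.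
case: ifP => // _; rewrite -alpha_sum1 (bigD1 i) //= lerDl.
exact: sumr_ge0.
Qed.

(** Erasing letters [k] with total probability [e = 1 / M] lowers the arrival rate to
    [a' = alpha k - e], while server [j < k] works at rate [alpha j >= alpha k]; the means
    [a' / (alpha j - a')] are at most [a' * M]. The test [x.1 == k] occurs twice because the marks
    given to [row_ge_tandem] already include it. *)
Lemma tandem_moment (M n : nat) : (0 < M)%N -> M%:R^-1 < alpha k ->
  Exp (coin_prob (M%:R^-1 / alpha k)) n (fun s =>
    (load (run (serve k) [seq if (x.2 && (x.1 == k)) && (x.1 == k) then None else Some x.1 | x <- s]
       [ffun=> 0%N]))%:R ^+ 2)
  <= 2 * (M%:R ^+ 2 + M%:R).
Proof.
move=> M0; set e := M%:R^-1 => ea; set t := e / alpha k.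
have MR : 0 < M%:R :> R by rewrite ltr0n.
have eM : e * M%:R = 1 by rewrite mulVf ?gt_eqF.
have e0 : 0 < e by rewrite invr_gt0.
have ak0 : 0 < alpha k by exact: lt_trans ea.
have ta : t * alpha k = e by rewrite /t divfK // gt_eqF.
pose a' := alpha k - e.
have a'0 : 0 < a' by rewrite subr_gt0.
have a'_ge0 := ltW a'0.
pose p (o : option 'I_d) := if o is Some j then alpha j - e * (j == k)%:R else e.
have pk : p (Some k) = a' by rewrite /p eqxx mulr1.
have pj j : j != k -> p (Some j) = alpha j by move=> /negPf jk; rewrite /p jk mulr0 subr0.
have p0 o : 0 <= p o.
  case: o => [j|]; last exact: ltW.
  by have [->|jk] := eqVneq j k; rewrite ?pk ?pj.
have psum1 : \sum_o p o = 1.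
  rewrite (bigD1 None) //= (reindex_omap Some id) //=; last by case.
  rewrite (eq_bigl xpredT) => [|j]; last by rewrite eqxx.
  rewrite sumrB alpha_sum1 -mulr_sumr (bigD1 k) //= eqxx big1 => [|i /negPf->//].
  by rewrite addr0 mulr1 addrC subrK.
rewrite (Exp_map (p := p) n (fun s => (load (run (serve k) s [ffun=> 0%N]))%:R ^+ 2)); last first.
  move=> y; rewrite (sum_coin_cond t (fun x =>
    (if (x.2 && (x.1 == k)) && (x.1 == k) then None else Some x.1) == y)) /=.
  case: y => [j|]; last first.
    rewrite (bigD1 k) //= eqxx /= big1 => [|i /negPf-> /=].
      by rewrite -ta; ring.
    by rewrite !mulr0 addr0 mulr0.
  rewrite /p (bigD1 j) //= eqxx big1 => [|i /negPf ij /=].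
    have [->|jk] := eqVneq j k; rewrite /= ?eqxx ?mulr1 -?ta; ring.
  have e1 : (Some i == Some j) = false by [].
  by case: (i == k); rewrite /= ?e1 !mulr0 addr0 mulr0.
have aj (j : 'I_d) : (j < k)%N -> e <= alpha j - a'.
  by move=> jk; have := alpha_noninc (ltnW jk); rewrite /a'; lra.
have aj0 (j : 'I_d) : (j < k)%N -> 0 < alpha j.
  by move=> jk; apply: lt_le_trans ak0 (alpha_noninc (ltnW jk)).
pose rho (j : 'I_d) := if (j < k)%N then a' / alpha j else 0.
pose m (j : 'I_d) := if (j < k)%N then a' / (alpha j - a') else 0.
have m0 j : 0 <= m j.
  rewrite /m; case: ifP => // jk; rewrite divr_ge0 // ltW //.
  exact: lt_le_trans (aj j jk).
have rho_m j : rho j * (1 + m j) = m j.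
  rewrite /rho /m; case: ifP => [jk|_]; last by rewrite mul0r.
  have g0 : alpha j - a' != 0 by rewrite gt_eqF // (lt_le_trans e0) ?aj.
  by field; rewrite g0 gt_eqF ?aj0.
have m_le j : m j <= (if (j < k)%N then a' else 0) * M%:R.
  rewrite /m; case: ifP => [jk|_]; last by rewrite mul0r.
  have g0 : 0 < alpha j - a' by rewrite (lt_le_trans e0) ?aj.
  rewrite ler_pdivrMr // -mulrA ler_peMr // -[X in X <= _]eM mulrC ler_wpM2l ?ler0n ?aj //.
have y_le (j : 'I_d) : (if (j < k)%N then a' else 0) <= a' by case: ifP.
have sum_le : \sum_(j : 'I_d) (if (j < k)%N then a' else 0) + a' <= 1.
  rewrite -alpha_sum1 (bigD1 k) //= ltnn add0r [X in _ <= X](bigD1 k) //= [X in X <= _]addrC lerD //.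
    by rewrite /a'; lra.
  apply: ler_sum => i _; case: ifP => // ik.
  by have := aj _ ik; lra.
apply: le_trans (_ : 2 * variance_bound m <= _); last first.
  rewrite ler_wpM2l //.
  apply: (@variance_bound_le _ _ _
    (fun j : 'I_d => if (j < k)%N then a' else 0) a') => //.
  by move=> j; rewrite m0 m_le.
apply: (@run_moment R _ _ rho m p m0 rho_m p0 psum1 (serve k) (serve_out k) (queue_good k) _ _ _ _ _ M).
- move=> Q; rewrite negb_forall => /existsP[i]; rewrite negb_imply -lt0n => /andP[ik Qi].
  by apply: (weight_bad (j := i)) => //; rewrite /rho ltnNge ik.
- move=> [j|] Q gQ //.
  have [act|nact] := boolP (active k j Q); last by rewrite /serve_out /serve (negPf nact).
  have -> : serve_out k (Some j) Q = Some (next_server k j) by rewrite /serve_out act.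
  have E : (if (j < k)%N then rho j else 1) * weight rho (serve k (Some j) Q) =
      (if next_server k j != k then rho (next_server k j) else 1) * weight rho Q.
    rewrite -!weight_incr; congr (weight rho _); apply/ffunP => i; rewrite !ffunE serveE //.
    congr (_ + _)%N; case: next_serverP => [j0|i' ij]; first by rewrite j0 eqxx.
    have -> : i' != k by rewrite -val_eqE /=; have := active_le act; lia.
    by rewrite -ij eqSS.
  (* With [pserved], this is flow balance: the throughput is [a'] at every server, at the entrance
     and at the exit. *)
  have pnext : p (Some (next_server k j)) * (if next_server k j != k then rho (next_server k j) else 1) = a'.
    case: eqP => [->|/eqP nk]; first by rewrite mulr1.
    have lt : (next_server k j < k)%N.
      move: nk; case: next_serverP => [_|i ij]; first by rewrite eqxx.
      by have := active_le act; lia.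
    by rewrite pj // /rho lt mulrC divfK // gt_eqF ?aj0.
  have pserved : p (Some j) * (if (j < k)%N then rho j else 1) = a'.
    case: ltnP => jk.
      by rewrite pj -?val_eqE /= ?ltn_eqF // /rho jk mulrC divfK // gt_eqF ?aj0.
    rewrite mulr1 -pk; congr (p (Some _)); apply: val_inj => /=.
    by apply/eqP; rewrite eqn_leq jk (active_le act).
  have a'n0 : a' != 0 by rewrite gt_eqF.
  apply: (mulfI a'n0); rewrite -[X in X * _ = _]pnext -[X in _ = X * _]pserved.
  by rewrite mulrACA -E [RHS]mulrACA [in RHS](mulrC (p (Some j))).
- exact: serve_inj.
- exact: serve_le.
- by move=> s Q _; apply: run_serve_mono.
move=> i; apply: le_trans (m_le i) _; rewrite ler_piMl ?ler0n //.
case: ifP => // _; have : alpha k <= 1; last by rewrite /a'; lra.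
by rewrite -alpha_sum1 (bigD1 k) //= lerDl; exact: sumr_ge0.
Qed.
End Row.

(** * Moments of a row *)

Section RowVersusCount.
Variables (n d : nat) (w : {ffun 'I_n -> 'I_d}) (k : 'I_d).
Local Open Scope nat_scope.

Definition letter_count := count (fun t => w t == k) (enum 'I_n).

Lemma enum_ord_pairwise : pairwise (fun s t : 'I_n => s < t) (enum 'I_n).
Proof.
have : pairwise ltn (map val (enum 'I_n)).
  by rewrite val_enum_ord -sorted_pairwise ?iota_ltn_sorted //; exact: ltn_trans.
by rewrite pairwise_map.
Qed.

Lemma row_add : shRSK_row w k + greene w k = greene w k.+1.
Proof. by rewrite /shRSK_row subnK ?greene_mono. Qed.

Lemma card_count_enum (D : {set 'I_n}) : #|D| = count (fun t => t \in D) (enum 'I_n).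
Proof. by rewrite cardE {1}/enum_mem size_filter enumT; apply: eq_count. Qed.

Lemma row_le_insertion (c : 'I_n -> bool) :
  shRSK_row w k <= letter_count +
    (load (run (insert k) [seq if c t then k else w t | t <- enum 'I_n] [ffun=> 0])
     + 2 * count c (enum 'I_n)).
Proof.
have [D [/forallP incD geD] le] := greene_succ_le w (ltn_ord k).
have rD : shRSK_row w k <= #|D| by have := row_add; lia.
apply: leq_trans rD _; rewrite card_count_enum.
apply: (@chain_load d k _ (enum 'I_n) w c (fun t => t \in D)).
  rewrite (sorted_pairwise leq_trans) pairwise_map.
  have := enum_ord_pairwise => /(subseq_pairwise (filter_subseq (fun t => t \in D) _)).
  apply: sub_in_pairwise (filter_all _ _) => s t /= sD tD st.
  by apply: (implyP (forallP (incD s) t)); rewrite sD tD.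
by apply/allP => t _; apply/implyP; apply: geD.
Qed.

Lemma row_ge_tandem (c : 'I_n -> bool) :
  letter_count <= shRSK_row w k +
    (load (run (serve k)
      [seq if c t && (w t == k) then None else Some (w t) | t <- enum 'I_n] [ffun=> 0])
     + count c (enum 'I_n)).
Proof.
have [u uk le] := greene_succ_ge w (ltn_ord k).
have uanti s t : s <= t -> u t <= u s.
  elim: t => [|t IH]; first by rewrite leqn0 => /eqP->.
  rewrite leq_eqVlt ltnS => /orP[/eqP->//|/IH]; apply: leq_trans.
  by case/andP: (uk t).
have ru : #|[set t : 'I_n | w t == u t :> nat]| <= shRSK_row w k by have := row_add; lia.
rewrite card_count_enum in ru.
rewrite /letter_count; have := @path_load d k _ (enum 'I_n) w c (fun t : 'I_n => u t).
have E : count (fun t => t \in [set t : 'I_n | w t == u t :> nat]) (enum 'I_n) =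
         count (fun t : 'I_n => w t == u t :> nat) (enum 'I_n).
  by apply: eq_count => t; rewrite /= inE.
rewrite E in ru.
move=> H; apply: leq_trans (H _ _) _; last by rewrite leq_add2r.
  rewrite (sorted_pairwise (rev_trans leq_trans)) pairwise_map.
  apply: sub_pairwise enum_ord_pairwise => s t /ltnW; exact: uanti.
by apply/allP => t _; case/andP: (uk t).
Qed.

Lemma row_le_n : shRSK_row w k <= n.
Proof.
have [D _ le] := greene_succ_le w (ltn_ord k).
have : #|D| <= n by rewrite -[X in _ <= X]card_ord max_card.
by have := row_add; lia.
Qed.
End RowVersusCount.

Lemma map_nth_enum (T S : Type) (x0 : T) n (s : seq T) (f : T -> S) : size s = n ->
  [seq f (nth x0 s t) | t : 'I_n <- enum 'I_n] = map f s.
Proof.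
move=> <-; rewrite (map_comp (fun t => f (nth x0 s t)) val) val_enum_ord.
by rewrite map_comp map_nth_iota0 ?take_size.
Qed.

Lemma count_nth_enum (T : Type) (x0 : T) n (s : seq T) (f : pred T) : size s = n ->
  count (fun t : 'I_n => f (nth x0 s t)) (enum 'I_n) = count f s.
Proof. by move=> sz; rewrite -(count_map (fun t : 'I_n => nth x0 s t)) (map_nth_enum _ id) ?map_id. Qed.

Section Moments.
Variables (R : realFieldType) (d : nat) (alpha : 'I_d -> R).
Hypothesis alpha_ge0 : forall i, 0 <= alpha i.
Hypothesis alpha_sum1 : \sum_i alpha i = 1.
Hypothesis alpha_noninc : forall i j : 'I_d, (i <= j)%N -> alpha j <= alpha i.
Variables (k : 'I_d) (n : nat).

Definition word_of (s : seq 'I_d) : {ffun 'I_n -> 'I_d} := [ffun t : 'I_n => nth k s t].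

Lemma word_of_codom (w : {ffun 'I_n -> 'I_d}) : word_of (codom w) = w.
Proof.
apply/ffunP => t; rewrite ffunE codomE (nth_map t) ?size_enum_ord //.
by rewrite nth_ord_enum.
Qed.

Lemma letter_count_word s : size s = n -> letter_count (word_of s) k = count (pred1 k) s.
Proof.
move=> sz; rewrite /letter_count -(count_nth_enum k (pred1 k) sz).
by apply: eq_count => t; rewrite /= ffunE.
Qed.

Lemma alpha_le1 : alpha k <= 1.
Proof. by rewrite -alpha_sum1 (bigD1 k) //= lerDl; exact: sumr_ge0. Qed.

(** The truncated difference is the positive part of row minus count. It is at most the load [Y]
    plus twice the number of marks, and [(Y + 2 c)^2 <= 2 Y^2 + 8 c^2]. *)
Lemma upper_moment (M : nat) : (0 < M)%N ->
  Exp alpha n (fun s => (shRSK_row (word_of s) k - count (pred1 k) s)%N%:R ^+ 2) <=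
  4 * (M%:R ^+ 2 + M%:R) + 8 * (n%:R / M%:R + (n%:R / M%:R) ^+ 2).
Proof.
move=> M0; set e : R := M%:R^-1.
have MR : 0 < M%:R :> R by rewrite ltr0n.
have e01 : 0 <= e <= 1 by rewrite invr_ge0 ler0n invf_le1 // ler1n.
have q0 x : 0 <= coin_prob alpha e x by exact: coin_prob_ge0.
rewrite -(Exp_map n _ (coin_prob_fst alpha e)).
pose Y (s : seq ('I_d * bool)) := load (run (insert k) [seq if x.2 then k else x.1 | x <- s] [ffun=> 0%N]).
apply: le_trans (_ : Exp (coin_prob alpha e) n (fun s =>
    2 * (Y s)%:R ^+ 2 + 8 * (count snd s)%:R ^+ 2) <= _).
  apply: le_Exp => // s sz; pose x0 := (k, false).
  have sz1 : size (map fst s) = n by rewrite size_map.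
  have := row_le_insertion (word_of (map fst s)) k (fun t : 'I_n => (nth x0 s t).2).
  rewrite (letter_count_word sz1) (count_nth_enum x0 snd sz).
  rewrite (_ : [seq if (nth x0 s t).2 then k else word_of (map fst s) t | t : 'I_n <- enum 'I_n] =
      [seq if x.2 then k else x.1 | x <- s]); last first.
    rewrite -[RHS](map_nth_enum x0 _ sz); apply: eq_map => t.
    by rewrite ffunE (nth_map x0) ?sz.
  rewrite -/(Y s) -leq_subLR => le.
  apply: le_trans (_ : (Y s + 2 * count snd s)%N%:R ^+ 2 <= _).
    by rewrite lerXn2r ?nnegrE ?ler0n // ler_nat.
  rewrite natrD natrM; have := sqr_ge0 ((Y s)%:R - 2 * (count snd s)%:R : R).
  by rewrite sqrrB sqrrD; lra.
rewrite ExpD !ExpZ lerD //.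
  have := insertion_moment alpha_ge0 alpha_sum1 alpha_noninc k n M0; rewrite -/e -/Y; lra.
rewrite ler_wpM2l //; apply: Exp_count_sqr => //; first exact: coin_prob_sum.
rewrite (sum_coin_cond alpha e snd) /= (eq_bigr (fun i => alpha i * e)) => [|i _]; last by ring.
by rewrite -mulr_suml alpha_sum1 mul1r.
Qed.

Lemma lower_moment (M : nat) : (0 < M)%N ->
  Exp alpha n (fun s => (count (pred1 k) s - shRSK_row (word_of s) k)%N%:R ^+ 2) <=
  4 * (M%:R ^+ 2 + M%:R) + 2 * (n%:R / M%:R + (n%:R / M%:R) ^+ 2).
Proof.
move=> M0; set e : R := M%:R^-1.
have MR : 0 < M%:R :> R by rewrite ltr0n.
have e0 : 0 <= e by rewrite invr_ge0 ler0n.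
have rhs0 : 0 <= M%:R ^+ 2 + M%:R :> R by rewrite addr_ge0 ?exprn_ge0 ?ler0n.
have ne0 : 0 <= n%:R * e + (n%:R * e) ^+ 2 by rewrite addr_ge0 ?sqr_ge0 ?mulr_ge0 ?ler0n.
(* If [alpha k <= 1 / M] there are too few letters [k] to erase, but then their number alone
   satisfies the bound. *)
have [ae|ea] := lerP (alpha k) e.
  apply: le_trans (_ : Exp alpha n (fun s => (count (pred1 k) s)%:R ^+ 2) <= _).
    by apply: le_Exp => // s _; rewrite lerXn2r ?nnegrE ?ler0n // ler_nat leq_subr.
  apply: le_trans (Exp_count_sqr (e := e) _ _ _ _) _ => //; last by lra.
  by rewrite big_pred1_eq.
have ak0 : 0 < alpha k by exact: le_lt_trans ea.
set t := e / alpha k.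
have t01 : 0 <= t <= 1 by rewrite divr_ge0 //= ler_pdivrMr // mul1r ltW.
have q0 x : 0 <= coin_prob alpha t x by exact: coin_prob_ge0.
rewrite -(Exp_map n _ (coin_prob_fst alpha t)).
pose f (x : 'I_d * bool) := x.2 && (x.1 == k).
pose Y (s : seq ('I_d * bool)) := load (run (serve k)
  [seq if (x.2 && (x.1 == k)) && (x.1 == k) then None else Some x.1 | x <- s] [ffun=> 0%N]).
apply: le_trans (_ : Exp (coin_prob alpha t) n (fun s =>
    2 * (Y s)%:R ^+ 2 + 2 * (count f s)%:R ^+ 2) <= _).
  apply: le_Exp => // s sz; pose x0 := (k, false).
  have sz1 : size (map fst s) = n by rewrite size_map.
  have := row_ge_tandem (word_of (map fst s)) k (fun t : 'I_n => f (nth x0 s t)).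
  rewrite (letter_count_word sz1) (count_nth_enum x0 f sz).
  rewrite (_ : [seq if f (nth x0 s t) && (word_of (map fst s) t == k) then None
      else Some (word_of (map fst s) t) | t : 'I_n <- enum 'I_n] =
      [seq if (x.2 && (x.1 == k)) && (x.1 == k) then None else Some x.1 | x <- s]); last first.
    rewrite -[RHS](map_nth_enum x0 _ sz); apply: eq_map => t'.
    by rewrite ffunE (nth_map x0) ?sz.
  rewrite -/(Y s) -leq_subLR => le.
  apply: le_trans (_ : (Y s + count f s)%N%:R ^+ 2 <= _).
    by rewrite lerXn2r ?nnegrE ?ler0n // ler_nat.
  rewrite natrD; have := sqr_ge0 ((Y s)%:R - (count f s)%:R : R).
  by rewrite sqrrB sqrrD; lra.
rewrite ExpD !ExpZ lerD //.
  have := tandem_moment alpha_ge0 alpha_sum1 alpha_noninc n M0 ea; rewrite -/e -/t -/Y; lra.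
rewrite ler_wpM2l //; apply: Exp_count_sqr => //; first exact: coin_prob_sum.
rewrite (sum_coin_cond alpha t f) /f /= (bigD1 k) //= eqxx big1 => [|i /negPf->]; last by rewrite /=; ring.
by rewrite !mulr0 !addr0 mulr1 /t mulrC divfK // gt_eqF.
Qed.

Lemma count_variance :
  Exp alpha n (fun s => ((count (pred1 k) s)%:R - n%:R * alpha k) ^+ 2) <= n%:R.
Proof.
pose f j : R := (j == k)%:R - alpha k.
apply: le_trans (_ : Exp alpha n (fun s => (\sum_(x <- s) f x) ^+ 2) <= _).
  apply: le_Exp => // s <-.
  have -> : \sum_(x <- s) f x = (count (pred1 k) s)%:R - (size s)%:R * alpha k; last by [].
  elim: s => [|x s IH]; first by rewrite big_nil /=; ring.
  by rewrite big_cons IH /= natrD -natr1 /f; ring.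
rewrite Exp_sum_sqr //.
have -> : \sum_j alpha j * f j = 0.
  rewrite /f (eq_bigr (fun j => alpha j * (j == k)%:R - alpha j * alpha k)) => [|j _]; last by ring.
  by rewrite sumrB sum_alpha_pred -mulr_suml alpha_sum1 mul1r subrr.
rewrite expr0n mulr0 addr0 ler_piMr ?ler0n // -alpha_sum1.
apply: ler_sum => j _; rewrite ler_piMr // /f.
have := alpha_le1; have := alpha_ge0 k.
by case: eqP => _ /=; rewrite ?mulr1n ?mulr0n expr2; nra.
Qed.

Lemma row_moment : (0 < n)%N ->
  Exp alpha n (fun s => ((shRSK_row (word_of s) k)%:R / n%:R - alpha k) ^+ 2) <= 46 / n%:R.
Proof.
move=> n0; have nR : 0 < n%:R :> R by rewrite ltr0n.
(* [M] is the integer square root of [n], which balances [M ^+ 2] against [(n / M) ^+ 2]. *)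
have [M M0 /andP[Mn nM]] : exists2 M, (0 < M)%N & (M * M <= n <= M * M + 2 * M)%N.
  elim: n n0 => // m IH _; have [->|m0] := posnP m; first by exists 1%N.
  have [M M0 /andP[h1 h2]] := IH m0.
  have [h3|h3] := leqP m.+1 (M * M + 2 * M); first by exists M => //; lia.
  by exists M.+1 => //; lia.
(* For [M < 3] one has [n <= 8], and the trivial bound [1] is enough. *)
have [M3|M3] := leqP 3 M; last first.
  have n46 : 1 <= 46 / n%:R :> R by rewrite ler_pdivlMr // mul1r ler_nat; nia.
  apply: le_trans n46; rewrite -[X in _ <= X](Exp_const n 1 alpha_sum1).
  apply: le_Exp => // s _; have := row_le_n (word_of s) k; set r := shRSK_row _ _ => rn.
  have : r%:R / n%:R <= 1 :> R by rewrite ler_pdivrMr // mul1r ler_nat.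
  have : 0 <= r%:R / n%:R :> R by rewrite divr_ge0 ?ler0n.
  by have := alpha_le1; have := alpha_ge0 k; rewrite expr2; nra.
pose r s := shRSK_row (word_of s) k; pose N (s : seq 'I_d) := count (pred1 k) s.
(* Here [(a + b)^2 <= 5 a^2 + 5/4 b^2], with [a] the fluctuation of the count and [b] the row minus
   the count, split into its positive and negative parts, one of which vanishes. *)
apply: le_trans (_ : Exp alpha n (fun s => n%:R^-1 ^+ 2 *
  (5 * ((N s)%:R - n%:R * alpha k) ^+ 2 +
   (5 / 4 * (r s - N s)%N%:R ^+ 2 + 5 / 4 * (N s - r s)%N%:R ^+ 2))) <= _).
  apply: le_Exp => // s _; rewrite -/(r s).
  have -> : (r s)%:R / n%:R - alpha k = n%:R^-1 * ((r s)%:R - n%:R * alpha k).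
    by field; rewrite gt_eqF.
  rewrite exprMn ler_wpM2l ?sqr_ge0 // -mulrDr.
  have -> : (r s - N s)%N%:R ^+ 2 + (N s - r s)%N%:R ^+ 2 = ((r s)%:R - (N s)%:R) ^+ 2 :> R.
    have [le|/ltnW le] := leqP (r s) (N s); rewrite (eqP le) natrB // expr0n /=; ring.
  set x : R := (N s)%:R; set y : R := (r s)%:R; set z := n%:R * alpha k.
  by have := sqr_ge0 (2 * (x - z) - (y - x) / 2); rewrite !expr2; lra.
rewrite ExpZ !ExpD !ExpZ; have U := upper_moment M0; have L := lower_moment M0.
have C := count_variance; rewrite -/N in C.
rewrite -/N in U L.
set m : R := M%:R in U L; set v : R := n%:R in nR U L C *.
have m3 : 3 <= m by rewrite ler_nat.
have m0 : 0 < m by lra.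
have mv : m * m <= v by rewrite -natrM ler_nat.
have vm : v <= m * m + 2 * m by rewrite -!natrM -natrD ler_nat.
have xm : v / m * m = v by rewrite divfK // gt_eqF.
set x := v / m in xm U L.
have x0 : 0 < x by rewrite divr_gt0.
have xm2 : x <= m + 2 by rewrite ler_pdivrMr //; lra.
have xx : x * x <= v + 2 * x by nra.
have x3 : 3 * x <= v by nra.
have mm : 3 * m <= v by nra.
have -> : 46 / v = v^-1 ^+ 2 * (46 * v) by field; rewrite gt_eqF.
(* The total [5 v + 10 (m^2 + m) + 25/2 (x + x^2)] is at most [130/3 v], which is below [46 v]. *)
rewrite ler_wpM2l ?sqr_ge0 //; rewrite !expr2 in U L; lra.
Qed.
End Moments.

(** * Summation over the first [k] rows *)

Theorem mainTheorem4 (R : realFieldType) (d n k : nat) (alpha : 'I_d -> R)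
  (alpha_ge0 : forall i, 0 <= alpha i)
  (alpha_sum1 : \sum_(i : 'I_d) alpha i = 1)
  (alpha_noninc : forall i j : 'I_d, (i <= j)%N -> alpha j <= alpha i)
  (n_ge1 : (1 <= n)%N) (k_ge1 : (1 <= k)%N) (k_le_d : (k <= d)%N) :
  \sum_(w : {ffun 'I_n -> 'I_d})
     word_prob alpha w *
     (\sum_(i : 'I_d | (i < k)%N) ((shRSK_row w i)%:R / n%:R - alpha i) ^+ 2)
  <= (46 * k)%:R / n%:R.
Proof.
under eq_bigr do rewrite mulr_sumr.
rewrite exchange_big /=.
apply: le_trans (_ : \sum_(i : 'I_d | (i < k)%N) 46 / n%:R <= _).
  apply: ler_sum => i _; apply: le_trans (row_moment alpha_ge0 alpha_sum1 alpha_noninc i n_ge1).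
  by rewrite -Exp_ffun; apply: ler_sum => w _; rewrite word_of_codom.
rewrite sumr_const -[_ *+ _]mulr_natr mulrAC -natrM ler_wpM2r ?invr_ge0 ?ler0n //.
rewrite ler_nat leq_mul2l /= -[X in (_ <= X)%N](card_ord k) -(card_image (f := widen_ord k_le_d)).
  by apply/subset_leq_card/subsetP => i ik; apply/imageP; exists (Ordinal ik) => //; apply: val_inj.
by move=> i j [] /val_inj.
Qed.
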